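(* Timeline Vertex Cover is NP-hard, even when restricted to instances with $k=2$, $\ell=0$, $\mathrm{imw}=4$, in which each edge of the underlying graph appears in exactly one snapshot and the underlying graph has maximum degree bounded by a constant.
   Context: A temporal graph $\mathcal{G}=(G_1,\dots,G_T)$ is a finite sequence of simple undirected graphs (snapshots) on a common finite vertex set $V$, $E_i=E(G_i)$; its underlying graph is $(V,E_\downarrow)$ with $E_\downarrow=\bigcup_i E_i$. A temporal edge is $(e,i)$ with $e\in E_i$. An activity interval is a triple $(v,a,b)$ with $v\in V$, $1\le a\le b\le T$; its length is $b-a$. A $k$-activity $\ell$-timeline is a set of activity intervals with at most $k$ intervals per vertex, each of length at most $\ell$. A vertex $v$ is active at time $i$ if some $(v,a,b)$ in the timeline has $a\le i\le b$; the timeline covers $(uv,i)$ if $u$ or $v$ is active at time $i$. Timeline Vertex Cover: given $\mathcal{G}$ and integers $k\ge1,\ell\ge0$, decide whether some $k$-activity $\ell$-timeline covers all temporal edges. The interval-membership sequence is $(F_i)_{i\in[T]}$ with $F_i=\{e\in E_\downarrow:\exists p\le i\le q,\ e\in E_p\cap E_q\}$, and the interval-membership-width is $\mathrm{imw}(\mathcal{G})=\max_i|F_i|$. *)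

(* Defs.v *)
From HB Require Import structures.
From mathcomp Require Import all_boot all_order all_algebra.

Set Implicit Arguments.
Unset Strict Implicit.
Unset Printing Implicit Defensive.

(** * Polynomial time, NP and NP-hardness

    The model is the deterministic multi-tape Turing machine with two-way
    infinite tapes over an arbitrary finite alphabet. *)

Inductive move := MoveL | MoveS | MoveR.

Definition shift (m : move) : int :=
  match m with MoveL => (- 1)%R | MoveS => 0%R | MoveR => 1%R end.

Record TM := MkTM {
  tm_state : finType;
  tm_sym : finType;
  tm_tapes : nat;  (* the machine has [tm_tapes.+1] tapes *)
  tm_start : tm_state;
  tm_halt : pred tm_state;
  tm_blank : tm_sym;
  tm_bit : bool -> tm_sym;
  tm_bit_inj : injective tm_bit;
  tm_bit_blank : forall b, tm_bit b != tm_blank;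
  tm_delta : tm_state -> {ffun 'I_tm_tapes.+1 -> tm_sym} ->
             tm_state * {ffun 'I_tm_tapes.+1 -> tm_sym * move} }.

Record config (M : TM) := Config {
  c_state : tm_state M;
  c_tape : 'I_(tm_tapes M).+1 -> int -> tm_sym M;
  c_head : 'I_(tm_tapes M).+1 -> int }.

(* [w] written on the cells 0, ..., size w - 1, all other cells blank. *)
Definition word_tape (M : TM) (w : seq bool) (z : int) : tm_sym M :=
  if z is Posz i then nth (tm_blank M) (map (@tm_bit M) w) i else tm_blank M.

Definition init_config (M : TM) (w : seq bool) : config M :=
  Config (tm_start M)
         (fun j => word_tape M (if j == ord0 then w else [::]))
         (fun=> 0%R).

(* Halting configurations are fixed points of [step]. *)
Definition step (M : TM) (c : config M) : config M :=
  if tm_halt (c_state c) then c else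
  let: (q, act) :=
    tm_delta (c_state c) [ffun j => c_tape c j (c_head c j)] in
  Config q
         (fun j z => if z == c_head c j then (act j).1 else c_tape c j z)
         (fun j => c_head c j + shift (act j).2)%R.

(* Input on the first tape, output on the last one (the same tape when there is
   only one). Since halting configurations are fixed, this says that [M] halts
   after at most [t (size w)] steps. *)
Definition computes_in_time (M : TM) (f : seq bool -> seq bool)
    (t : nat -> nat) : Prop :=
  forall w : seq bool,
    let c := iter (t (size w)) (@step M) (init_config M w) in
    tm_halt (c_state c) /\ forall z, c_tape c ord_max z = word_tape M (f w) z.

Definition polynomial_time (f : seq bool -> seq bool) : Prop :=
  exists (M : TM) (c d : nat), computes_in_time M f (fun n => c * n ^ d + c).

(* Self-delimiting code: a bit 1 before every bit of [w], then a final 0. *)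
Definition delimit (w : seq bool) : seq bool :=
  flatten [seq [:: true; b] | b <- w] ++ [:: false].

Definition pair_code (x y : seq bool) : seq bool := delimit x ++ y.

Definition NP (L : seq bool -> Prop) : Prop :=
  exists (V : seq bool -> bool) (c d : nat),
    polynomial_time (fun w => [:: V w]) /\
    forall x, L x <->
      exists y, size y <= c * size x ^ d + c /\ V (pair_code x y).

Record decision_problem := DecisionProblem {
  instance : Type;
  encode : instance -> seq bool;
  yes_instance : instance -> Prop }.

(* NP-hardness of [P] restricted to the instances satisfying [D]: the reductions
   only produce instances satisfying [D]. *)
Definition NP_hard_on (P : decision_problem) (D : instance P -> Prop) : Prop :=
  forall L, NP L ->
    exists f : seq bool -> instance P,
      [/\ polynomial_time (fun x => encode (f x)),
          forall x, D (f x)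
        & forall x, L x <-> yes_instance (f x)].

(** * Temporal graphs

    Times are numbered 0, ..., T - 1, and a simple undirected graph on [V] is
    given by its set of edges, which are two-element subsets of [V]. *)

Record temporal_graph (V : finType) (T : nat) := TemporalGraph {
  snapshot : 'I_T -> {set {set V}};
  snapshot_simple : forall i e, e \in snapshot i -> #|e| = 2 }.

Section TemporalGraph.
Variables (V : finType) (T : nat) (G : temporal_graph V T).

Definition underlying_edges : {set {set V}} := \bigcup_(i < T) snapshot G i.

Definition underlying_degree (v : V) : nat :=
  #|[set e in underlying_edges | v \in e]|.

Definition interval_membership (i : 'I_T) : {set {set V}} :=
  [set e in underlying_edges | [exists p : 'I_T, exists q : 'I_T,
     (p <= i <= q) && (e \in snapshot G p :&: snapshot G q)]].

Definition imw : nat := \max_(i < T) #|interval_membership i|.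

Definition each_edge_once : Prop :=
  forall e, e \in underlying_edges -> #|[set i | e \in snapshot G i]| = 1.

(* The triple [(v, a, b)] is an activity interval when [a <= b]. *)
Definition is_timeline (k l : nat) (S : {set V * 'I_T * 'I_T}) : Prop :=
  [/\ forall v a b, (v, a, b) \in S -> a <= b,
      forall v a b, (v, a, b) \in S -> b - a <= l
    & forall v, #|[set I in S | I.1.1 == v]| <= k].

Definition active (S : {set V * 'I_T * 'I_T}) (v : V) (i : 'I_T) : Prop :=
  exists a b : 'I_T, (v, a, b) \in S /\ a <= i <= b.

Definition covers_all (S : {set V * 'I_T * 'I_T}) : Prop :=
  forall i e, e \in snapshot G i -> exists2 v, v \in e & active S v i.

End TemporalGraph.

(** * Timeline Vertex Cover *)

Record tvc_instance := TVCInstance {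
  tvc_n : nat;
  tvc_T : nat;
  tvc_graph : temporal_graph 'I_tvc_n tvc_T;
  tvc_k : nat;
  tvc_l : nat;
  tvc_k_gt0 : 0 < tvc_k }.

(* Binary digits, least significant first; [:: false] for 0. *)
Definition binary (m : nat) : seq bool :=
  mkseq (fun i => odd (m %/ 2 ^ i)) (trunc_log 2 m).+1.

Definition unary (m : nat) : seq bool := rcons (nseq m true) false.

(* The numbers of vertices and of snapshots in unary, [k] and [l] in binary, then
   the adjacency matrices of the snapshots, row by row. *)
Definition tvc_encode (I : tvc_instance) : seq bool :=
  unary (tvc_n I) ++ unary (tvc_T I) ++
  delimit (binary (tvc_k I)) ++ delimit (binary (tvc_l I)) ++
  flatten [seq flatten [seq [seq [set u; v] \in snapshot (tvc_graph I) i
                              | v <- enum 'I_(tvc_n I)]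
                         | u <- enum 'I_(tvc_n I)]
            | i <- enum 'I_(tvc_T I)].

Definition tvc_yes (I : tvc_instance) : Prop :=
  exists S, is_timeline (tvc_k I) (tvc_l I) S /\ covers_all (tvc_graph I) S.

Definition timeline_vertex_cover : decision_problem :=
  DecisionProblem tvc_encode tvc_yes.

(* Main.v *)
From HB Require Import structures.
Require Import Defs.
From Stdlib Require Import FunctionalExtensionality.
From mathcomp Require Import all_boot all_order all_algebra zify ring.

Set Implicit Arguments.
Unset Strict Implicit.
Unset Printing Implicit Defensive.

(** An accepting computation of a verifier is a tiling of a grid in which every tile
    carries the state, the scanned symbols and, for each tape, the symbol of its cell
    and the side on which the head lies; all constraints then relate horizontal or
    vertical neighbours, and only the labels of the first row depend on the input.

    Tilings become timelines as follows. With two activity points per vertex, a vertex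
    with edges in three snapshots is inactive in one of them, and an inactive vertex
    forces its neighbours of that snapshot to be active. So such vertices express
    clauses, stars copy a truth value, and a vertex also joined to an exhausted vertex
    relays a truth value or, as the common neighbour of two tiles, forbids that pair.
    Exhausted vertices come from a complete graph on five vertices whose ten edges lie
    in ten snapshots: its ten activity points are all needed there. Each snapshot of a
    cell only involves that cell, the next one and the one below, so a machine with a
    bounded number of tapes prints the instance by nested loops over the cells. *)

(** * Structured programs for multi-tape machines *)

(** The degree bound is chosen before the language, whereas the number [m] of tiles grows with the
    verifier; so neither a clause with [m] literals nor a star with [m] leaves is affordable. The
    clause saying that some tile is chosen is therefore cut into a chain of vertices with three
    demands each, and the value of a tile travels along a chain of relays, one for each possible
    partner. Every vertex then meets at most 7 snapshots with at most 4 edges each, whence the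
    degree bound 28. Uniqueness of the chosen tile is not enforced: any inactive clause may serve as
    the tile of its cell. Since no edge occurs twice, the interval-membership-width is the largest
    size of a snapshot. The gadgets need at most three edges at a time, and a separate star with
    four edges brings the value to exactly 4. *)

Section Programs.
Variables (A : finType) (blank : A).

(* A tape state is a word written from cell 0 on, every other cell being blank,
   together with the position of the head. *)
Definition tapes := nat -> seq A * int.

Definition cell (w : seq A) (z : int) : A :=
  if z is Posz i then nth blank w i else blank.

Definition readings (s : tapes) (j : nat) : A := cell (s j).1 (s j).2.

Definition upd (s : tapes) (k : nat) (x : seq A * int) : tapes :=
  fun j => if j == k then x else s j.

Definition emit (s : tapes) (k : nat) (u : seq A) : tapes :=
  upd s k ((s k).1 ++ u, ((s k).2 + Posz (size u))%R).

Definition slide (s : tapes) (k : nat) (d : int) : tapes :=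
  upd s k ((s k).1, ((s k).2 + d)%R).

(** Writing happens only at the end of a tape, so one word describes a tape and nothing is ever
    erased. The appended letter may be any function of the scanned letters, which in a machine is a
    finite table. *)
Inductive prog :=
| Append of nat & ((nat -> A) -> A)
| Move of nat & bool
| Skip
| Seq of prog & prog
| While of nat & prog.

Definition dir (b : bool) : int := if b then 1%R else (- 1)%R.

Inductive exec : prog -> tapes -> tapes -> nat -> Prop :=
| ExecAppend k g (s : tapes) : (s k).2 = Posz (size (s k).1) ->
    exec (Append k g) s (emit s k [:: g (readings s)]) 1
| ExecMove k b s : exec (Move k b) s (slide s k (dir b)) 1
| ExecSkip s : exec Skip s s 1
| ExecSeq p q s s1 s2 t1 t2 :
    exec p s s1 t1 -> exec q s1 s2 t2 -> exec (Seq p q) s s2 (t1 + t2)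
| ExecWhileEnd j p s : readings s j = blank -> exec (While j p) s s 1
| ExecWhileStep j p s s1 s2 t1 t2 : readings s j != blank ->
    exec p s s1 t1 -> exec (While j p) s1 s2 t2 ->
    exec (While j p) s s2 (t1 + t2).+1.

(** A control point is an [option (state p)], with [None] for the end of [p]. For a loop, [state] is
    itself this option type: the end of the body is literally the point at which the test is
    made. *)
Fixpoint state (p : prog) : finType :=
  match p with
  | Append _ _ | Move _ _ | Skip => unit
  | Seq p q => (state p + state q)%type
  | While _ p => option (state p)
  end.

Fixpoint entry (p : prog) : state p :=
  match p with
  | Append _ _ | Move _ _ | Skip => tt
  | Seq p q => inl (entry p)
  | While _ p => None
  end.

Definition action := option (nat * (A + bool)).

Fixpoint delta (p : prog) : state p -> (nat -> A) -> option (state p) * action :=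
  match p with
  | Append k g => fun _ r => (None, Some (k, inl (g r)))
  | Move k b => fun _ _ => (None, Some (k, inr b))
  | Skip => fun _ _ => (None, None)
  | Seq p q => fun x r =>
      match x with
      | inl x => let: (y, a) := delta x r in
                 (Some (if y is Some y then inl y else inr (entry q)), a)
      | inr x => let: (y, a) := delta x r in
                 (omap inr y, a)
      end
  | While j p => fun x r =>
      match x with
      | None => (if r j == blank then None else Some (Some (entry p)), None)
      | Some x => let: (y, a) := delta x r in (Some y, a)
      end
  end.

Definition perform (a : action) (s : tapes) : tapes :=
  match a with
  | None => s
  | Some (k, inl c) => emit s k [:: c]
  | Some (k, inr b) => slide s k (dir b)
  end.

Definition legal (a : action) (s : tapes) : Prop :=
  if a is Some (k, inl _) then (s k).2 = Posz (size (s k).1) else True.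

Inductive path_from (p : prog) : option (state p) -> tapes ->
    option (state p) -> tapes -> nat -> Prop :=
| PathNil x s : path_from x s x s 0
| PathStep x y a s z s' t :
    delta x (readings s) = (y, a) -> legal a s ->
    path_from y (perform a s) z s' t -> path_from (Some x) s z s' t.+1.

Lemma path_trans p (x y z : option (state p)) s s1 s2 t1 t2 :
  path_from x s y s1 t1 -> path_from y s1 z s2 t2 ->
  path_from x s z s2 (t1 + t2).
Proof.
move=> H; elim: H z s2 t2 => //= {}x {}y a {}s z s' t E lg _ IH z' s2 t2 H2.
by rewrite addSn; apply: PathStep E lg _; apply: IH.
Qed.

Lemma path_seql p q (x y : option (state p)) s s' t :
  path_from x s y s' t ->
  let emb u := Some (if u is Some v then inl v else inr (entry q)) in
  @path_from (Seq p q) (emb x) s (emb y) s' t.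
Proof.
move=> H emb; elim: H => [{}x {}s|{}x {}y a {}s z {}s' {}t E lg _ IH].
  exact: PathNil.
by apply: (@PathStep (Seq p q) (inl x) (emb y) a) => //=; rewrite E.
Qed.

Lemma path_seqr p q (x y : option (state q)) s s' t :
  path_from x s y s' t ->
  @path_from (Seq p q) (omap inr x) s (omap inr y) s' t.
Proof.
elim => [{}x {}s|{}x {}y a {}s z {}s' {}t E lg _ IH]; first exact: PathNil.
by apply: (@PathStep (Seq p q) (inr x) (omap inr y) a) => //=; rewrite E.
Qed.

Lemma path_while j p (x y : option (state p)) s s' t :
  path_from x s y s' t ->
  @path_from (While j p) (Some x) s (Some y) s' t.
Proof.
elim => [{}x {}s|{}x {}y a {}s z {}s' {}t E lg _ IH]; first exact: PathNil.
by apply: (@PathStep (While j p) (Some x) (Some y) a) => //=; rewrite E.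
Qed.

Lemma exec_path p s s' t :
  exec p s s' t -> path_from (Some (entry p)) s None s' t.
Proof.
elim=> {p s s' t}.
- by move=> k g s lg; apply: PathStep; [reflexivity | exact: lg | exact: PathNil].
- by move=> k b s; apply: PathStep; [reflexivity | | exact: PathNil].
- by move=> s; apply: PathStep; [reflexivity | | exact: PathNil].
- move=> p q s s1 s2 t1 t2 _ IH1 _ IH2.
  exact: path_trans (path_seql q IH1) (path_seqr p IH2).
- move=> j p s r; apply: (@PathStep (While j p) None None None) => //=.
    by rewrite r eqxx.
  exact: PathNil.
- move=> j p s s1 s2 t1 t2 r _ IH1 _ IH2.
  apply: (@PathStep (While j p) None (Some (Some (entry p))) None) => //=.
    by rewrite (negPf r).
  exact: path_trans (path_while j IH1) IH2.
Qed.

Fixpoint bounded_by (K : nat) (p : prog) : bool :=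
  match p with
  | Append k _ | Move k _ => k <= K
  | Skip => true
  | Seq p q => bounded_by K p && bounded_by K q
  | While j p => (j <= K) && bounded_by K p
  end.

Lemma delta_bounded K p (x : state p) r k o :
  bounded_by K p -> (delta x r).2 = Some (k, o) -> k <= K.
Proof.
elim: p x => [k' g|k' b||p IHp q IHq|j p IHp] /=.
- by move=> _ le [<-].
- by move=> _ le [<-].
- by [].
- move=> [x|x] /andP[bp bq].
    by case E: (delta x r) (IHp x bp) => [y a] /= H /H.
  by case E: (delta x r) (IHq x bq) => [y a] /= H /H.
- move=> [x|] /andP[_ bp] //.
  by case E: (delta x r) (IHp x bp) => [y a] /= H /H.
Qed.

(** * Compilation of programs into Turing machines *)

Section Compile.
Variables (bit : bool -> A) (bit_inj : injective bit).
Variable (bit_blank : forall b, bit b != blank).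
Variables (K : nat) (p : prog).

Definition all_readings (r : {ffun 'I_K.+1 -> A}) (j : nat) : A :=
  if insub j is Some i then r i else blank.

Definition tape_action (a : action) (j : nat) (c : A) : A * move :=
  match a with
  | Some (k, o) => if j == k then
      match o with
      | inl c' => (c', MoveR)
      | inr b => (c, if b then MoveR else MoveL)
      end else (c, MoveS)
  | None => (c, MoveS)
  end.

Definition prog_tm : TM :=
  @MkTM (option (state p)) A K (Some (entry p)) (fun x => x == None) blank
    bit bit_inj bit_blank
    (fun x r => match x with
       | Some x => let: (y, a) := delta x (all_readings r) in
                   (y, [ffun j => tape_action a (val j) (r j)])
       | None => (None, [ffun j => (r j, MoveS)])
       end).

Definition simulates (c : config prog_tm) (x : option (state p)) (s : tapes) :=
  [/\ c_state c = x,
      forall j, c_tape c j =1 cell (s (val j)).1,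
      forall j, c_head c j = (s (val j)).2
    & forall j, K < j -> s j = ([::], 0%R)].

Lemma cell_rcons w c z :
  cell (rcons w c) z = if z == Posz (size w) then c else cell w z.
Proof.
case: z => [i|i] //=; rewrite nth_rcons.
case: (ltngtP i (size w)) => [lt|gt|->]; last by rewrite eqxx.
  by rewrite ifN //; apply/eqP => -[E]; rewrite E ltnn in lt.
by rewrite ifN ?nth_default 1?ltnW //; apply/eqP => -[E]; rewrite E ltnn in gt.
Qed.

(** A legal append writes on the first cell behind the word, which is how a word grows by one letter
    ([cell_rcons]). Tapes beyond [K] are empty, so both sides read a blank there. *)
Lemma simulates_step c x s y a :
  bounded_by K p -> simulates c (Some x) s ->
  delta x (readings s) = (y, a) -> legal a s ->
  simulates (step c) y (perform a s).
Proof.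
move=> bp [Ex Et Eh E0] Ed lg.
have Er : all_readings [ffun j => c_tape c j (c_head c j)] = readings s.
  apply: functional_extensionality => j; rewrite /all_readings.
  case: insubP => [i _ <-|]; first by rewrite ffunE Et Eh.
  by rewrite -ltnNge ltnS => /E0 E; rewrite /readings E.
rewrite /step Ex /= Er Ed.
have bk k o : a = Some (k, o) -> k <= K.
  by move=> E; apply: (@delta_bounded K p x (readings s) k o) => //; rewrite Ed.
split=> //=.
- move=> j z; rewrite !ffunE /= !Et !Eh.
  have E1 : (if z == (s (val j)).2 then cell (s (val j)).1 (s (val j)).2
             else cell (s (val j)).1 z) = cell (s (val j)).1 z.
    by case: eqP => // ->.
  case: a lg bk {Ed} => [[k [c'|b]]|] //= lg bk.
  + rewrite /emit /upd; case: (val j =P k) => [E|_] //=.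
    by rewrite cats1 cell_rcons -lg E.
  + by rewrite /slide /upd; case: (val j =P k) => [E|_] //=; rewrite -E.
- move=> j; rewrite !ffunE Eh.
  case: a lg bk {Ed} => [[k [c'|b]]|] /= lg bk.
  + by rewrite /emit /upd; case: (val j =P k) => [->|_] //=; rewrite GRing.addr0.
  + rewrite /slide /upd; case: (val j =P k) => [->|_] /=; last by rewrite GRing.addr0.
    by case: b {lg bk}.
  + by rewrite GRing.addr0.
- move=> j lt; rewrite -(E0 j lt).
  case: a lg bk {Ed} => [[k [c'|b]]|] //= _ /(_ _ _ erefl) le; rewrite /emit /slide /upd ifN //;
    by apply: contraL lt => /eqP ->; rewrite -leqNgt.
Qed.

Lemma simulates_path c x s y s' t :
  bounded_by K p -> simulates c x s -> path_from x s y s' t ->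
  simulates (iter t (@step _) c) y s'.
Proof.
move=> bp + H; elim: H c => //= {}x {}y a {}s z {}s' {}t E lg _ IH c H.
by rewrite -iterS iterSr; apply: IH; apply: simulates_step E lg.
Qed.

Definition input (w : seq bool) : tapes :=
  fun j => (if j == 0 then map bit w else [::], 0%R).

Lemma prog_polynomial_time f c d :
  bounded_by K p ->
  (forall w, exists s t, [/\ exec p (input w) s t, t <= c * size w ^ d + c
     & (s K).1 = map bit (f w)]) ->
  polynomial_time f.
Proof.
move=> bp H; exists prog_tm, c, d => w.
have [s [t [ex le out]]] := H w; cbv zeta.
set n := _ + c in le *.
have [] : simulates (iter t (@step _) (init_config prog_tm w)) None s.
  apply: simulates_path (exec_path ex) => //; split=> //= j.
    by rewrite /input /= => z; case: eqP => [->|/eqP ne] /=; [|rewrite ifN //].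
  by case: j.
(* The program may stop before the bound [n]; the remaining steps leave a halted configuration
   unchanged. *)
rewrite -(subnK le) iterD.
set cc := iter t _ _ => Est Et _ _.
have -> : iter (n - t) (@step _) cc = cc.
  by elim: (n - t) => //= i ->; rewrite /step Est.
split; first by rewrite Est.
move=> z.
by rewrite Et /= out.
Qed.

End Compile.
End Programs.

Lemma flatten_nseq (T : Type) (a b : nat) (x : T) :
  flatten (mkseq (fun=> nseq a x) b) = nseq (b * a) x.
Proof.
rewrite /mkseq; elim: b 0 => //= b IH i.
by rewrite IH mulSn nseqD.
Qed.

(** * Loops over tapes, with explicit running times *)

Section Loops.
Variables (A : finType) (blank : A).

Implicit Types (s : tapes A) (p : prog A).
Local Notation exec := (exec blank).
Local Notation readings := (readings blank).

(** Quantifying over the text [v] already printed makes the specification stable under sequencing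
    and loops. All tapes other than [k], heads included, must be given back as they were. *)
Definition emits p s k u T :=
  forall v, exists2 t, t <= T & exec p (emit s k v) (emit s k (v ++ u)) t.

Lemma emit0 s k : emit s k [::] = s.
Proof.
apply: functional_extensionality => j; rewrite /emit /upd cats0 GRing.addr0.
by case: eqP => // ->; case: (s k).
Qed.

Lemma emit_emit s k u v : emit (emit s k u) k v = emit s k (u ++ v).
Proof.
apply: functional_extensionality => j; rewrite /emit /upd eqxx /=.
by case: eqP => // _; rewrite catA size_cat PoszD GRing.addrA.
Qed.

Lemma emits_exec p s k u T :
  emits p s k u T -> exists2 t, t <= T & exec p s (emit s k u) t.
Proof. by move=> /(_ [::]); rewrite emit0. Qed.

Lemma emits_append s k g c : (s k).2 = Posz (size (s k).1) ->
  (forall v, g (readings (emit s k v)) = c) -> emits (Append k g) s k [:: c] 1.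
Proof.
move=> e H v; exists 1 => //; rewrite -emit_emit -(H v); apply: ExecAppend.
by rewrite /emit /upd eqxx /= e size_cat PoszD.
Qed.

Lemma emits_skip s k : emits (Skip A) s k [::] 1.
Proof. by move=> v; exists 1; rewrite // cats0; exact: ExecSkip. Qed.

Lemma emits_seq p q s k u v T1 T2 :
  emits p s k u T1 -> emits q s k v T2 -> emits (Seq p q) s k (u ++ v) (T1 + T2).
Proof.
move=> H1 H2 z; have [t1 l1 e1] := H1 z; have [t2 l2 e2] := H2 (z ++ u).
exists (t1 + t2); first exact: leq_add.
by rewrite catA; apply: ExecSeq e1 e2.
Qed.

Definition seqs (X : Type) (P : X -> prog A) (l : seq X) : prog A :=
  foldr (fun x q => Seq (P x) q) (Skip A) l.

Lemma emits_seqs (X : eqType) (P : X -> prog A) (l : seq X) s k u T :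
  (forall x, x \in l -> emits (P x) s k (u x) T) ->
  emits (seqs P l) s k (flatten (map u l)) (size l * T + 1).
Proof.
elim: l => [|x l IH] H; first exact: emits_skip.
rewrite /= mulSn -addnA; apply: emits_seq; first by apply: H; rewrite mem_head.
by apply: IH => y yl; apply: H; rewrite inE yl orbT.
Qed.

(** Net displacement of head [j] by one pass through the moves [l]; [slides l i] is the effect of
    [i] passes, and a negative [i] undoes them. *)
Definition offset (l : seq (nat * bool)) (j : nat) : int :=
  foldr (fun m z => ((if j == m.1 then dir m.2 else 0) + z)%R) 0%R l.

Definition slides (l : seq (nat * bool)) (i : int) s : tapes A :=
  fun j => ((s j).1, (s j).2 + i * offset l j)%R.

Lemma slides0 l s : slides l 0 s = s.
Proof.
apply: functional_extensionality => j.
by rewrite /slides GRing.mul0r GRing.addr0; case: (s j).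
Qed.

Lemma slidesD l i i' s : slides l i (slides l i' s) = slides l (i' + i)%R s.
Proof.
apply: functional_extensionality => j.
by rewrite /slides /= GRing.mulrDl GRing.addrA.
Qed.

Lemma emit_slides l i s k v : emit (slides l i s) k v = slides l i (emit s k v).
Proof.
apply: functional_extensionality => j; rewrite /emit /slides /upd.
by case: eqP => //= ->; congr pair; rewrite GRing.addrAC.
Qed.

Fixpoint moves (m : nat * bool) (l : seq (nat * bool)) : prog A :=
  if l is m' :: l' then Seq (Move A m.1 m.2) (moves m' l') else Move A m.1 m.2.

Lemma slide_slides m s : slide s m.1 (dir m.2) = slides [:: m] 1 s.
Proof.
apply: functional_extensionality => j; rewrite /slide /slides /upd /=.
case: eqP => [->|_]; first by congr pair; ring.
by rewrite [LHS]surjective_pairing; congr pair; ring.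
Qed.

Lemma exec_moves m l s : exec (moves m l) s (slides (m :: l) 1 s) (size l).+1.
Proof.
elim: l m s => [|m' l IH] m s /=.
  by rewrite -slide_slides; exact: ExecMove.
rewrite -[(_.+2)]add1n; apply: ExecSeq; first exact: ExecMove.
rewrite slide_slides.
have -> : slides [:: m, m' & l] 1 s = slides (m' :: l) 1 (slides [:: m] 1 s).
  by apply: functional_extensionality => j; rewrite /slides /=; congr pair; ring.
exact: IH.
Qed.

Definition back (l : seq (nat * bool)) := [seq (m.1, ~~ m.2) | m <- l].

Lemma offset_back l j : offset (back l) j = (- offset l j)%R.
Proof.
elim: l => [|m l IH] /=; first by rewrite GRing.oppr0.
rewrite IH GRing.opprD; case: eqP => _; last by rewrite GRing.oppr0.
by case: m.2; rewrite /dir ?GRing.opprK.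
Qed.

Lemma slides_back l i s : slides (back l) i s = slides l (- i)%R s.
Proof.
apply: functional_extensionality => j.
by rewrite /slides offset_back GRing.mulrN GRing.mulNr.
Qed.

(* [p] runs once for each letter of the word on tape [j]; the tapes listed in
   [l] are moved along with the head of [j], and are moved back at the end. *)
Definition foreach (j : nat) (l : seq (nat * bool)) (p : prog A) : prog A :=
  Seq (While j (Seq p (moves (j, true) l)))
    (Seq (Move A j false)
      (Seq (While j (moves (j, false) (back l))) (Move A j true))).

Lemma reading_slides l j s i : offset l j = 0%R -> (s j).2 = 0%R ->
  readings (slides ((j, true) :: l) i s) j = cell blank (s j).1 i.
Proof.
by move=> o e; rewrite /readings /slides /= eqxx o e /dir; congr cell; ring.
Qed.

Lemma emits_foreach j l p s k w h T :
  s j = (w, 0%R) -> blank \notin w -> j != k -> offset l j = 0%R ->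
  (forall i, i < size w ->
     emits p (slides ((j, true) :: l) (Posz i) s) k (h i) T) ->
  emits (foreach j l p) s k (flatten (mkseq h (size w)))
    (size w * (T + 2 * size l + 4) + 4).
Proof.
move=> sj bw jk lj H v.
have sjv v' : emit s k v' j = (w, 0%R) by rewrite /emit /upd (negPf jk).
set L := (j, true) :: l.
have nb i : i < size w -> nth blank w i != blank.
  by move=> lt; apply: contra bw => /eqP <-; exact: mem_nth.
have forth r i v' : i + r = size w ->
    exists2 t, t <= r * (T + size l + 2) + 1 &
      exec (While j (Seq p (moves (j, true) l))) (slides L (Posz i) (emit s k v'))
        (slides L (Posz (size w)) (emit s k (v' ++ flatten (map h (iota i r))))) t.
  elim: r i v' => [|r IH] i v' E.
    rewrite addn0 in E; exists 1; rewrite // E cats0; apply: ExecWhileEnd.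
    by rewrite reading_slides ?sjv //= nth_default.
  have lt : i < size w by lia.
  have [t1 l1 e1] := H i lt v'.
  have [|t2 l2 e2] := IH i.+1 (v' ++ h i); first lia.
  rewrite !emit_slides in e1.
  exists ((t1 + (size l).+1 + t2).+1); first by rewrite mulSn; lia.
  apply: ExecWhileStep.
  - by rewrite reading_slides ?sjv //= nb.
  - apply: ExecSeq e1 _; exact: exec_moves.
  - rewrite slidesD -PoszD addn1 /= catA; exact: e2.
(* On the way back the head of [j] is one cell ahead of its companions, because of the extra move
   onto the last letter. It meets the blank cell -1 after exactly [i] passes, when the companions
   are home; the final move to the right repairs [j]. *)
have bac i v' : i <= size w ->
    exec (While j (moves (j, false) (back l)))
      (slide (slides L (Posz i) (emit s k v')) j (- 1)%R)
      (slide (emit s k v') j (- 1)%R) (i * (size l + 2) + 1).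
  elim: i => [|i IH] le.
    rewrite slides0; apply: ExecWhileEnd.
    by rewrite /readings /slide /upd eqxx /= sjv.
  have -> : i.+1 * (size l + 2) + 1 =
      ((size (back l)).+1 + (i * (size l + 2) + 1)).+1.
    by rewrite size_map; lia.
  apply: ExecWhileStep.
  - rewrite /readings /slide /slides /upd eqxx /= eqxx lj sjv /=.
    by rewrite (_ : (_ - _)%N = i) ?nb //; lia.
  - exact: exec_moves.
  - suff -> : slides ((j, false) :: back l) 1
        (slide (slides L i.+1 (emit s k v')) j (-1)%R)
      = slide (slides L i (emit s k v')) j (-1)%R by apply: IH; exact: ltnW.
    rewrite -[(j, false) :: back l]/(back L) slides_back.
    apply: functional_extensionality => j'; rewrite /slide /slides /upd.
    by case: eqP => [->|_] /=; congr pair; rewrite (_ : Posz i.+1 = i + 1)%R; try ring; lia.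
have [|t1 l1 e1] := forth (size w) 0 v; first by rewrite add0n.
set v1 := v ++ _ in e1 *.
exists (t1 + (1 + (size w * (size l + 2) + 1 + 1))); first by lia.
apply: ExecSeq; first by rewrite -(slides0 L (emit s k v)); exact: e1.
apply: ExecSeq; first exact: (ExecMove _ j false).
apply: ExecSeq; first exact: bac.
have {2}-> : emit s k v1 = slide (slide (emit s k v1) j (- 1)%R) j (dir true).
  apply: functional_extensionality => j'; rewrite /slide /upd.
  by case: eqP => //= ->; rewrite eqxx /= GRing.subrK; case: (emit s k v1 j).
exact: ExecMove.
Qed.

Definition rewind (k : nat) : prog A :=
  Seq (Move A k false) (Seq (While k (Move A k false)) (Move A k true)).

Lemma exec_rewind s k w : s k = (w, Posz (size w)) -> blank \notin w ->
  exec (rewind k) s (upd s k (w, 0%R)) (2 * size w + 3).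
Proof.
move=> sk bw.
have bac i : i <= size w ->
    exec (While k (Move A k false)) (upd s k (w, Posz i - 1)%R)
      (upd s k (w, - 1)%R) (2 * i + 1).
  elim: i => [|i IH] le.
    by apply: ExecWhileEnd; rewrite /readings /upd eqxx.
  have -> : 2 * i.+1 + 1 = (1 + (2 * i + 1)).+1 by lia.
  apply: ExecWhileStep.
  - rewrite /readings /upd eqxx /=.
    rewrite (_ : (_ - _)%N = i); last by lia.
    by apply: contra bw => /eqP <-; exact: mem_nth.
  - exact: ExecMove.
  - rewrite (_ : slide _ _ _ = upd s k (w, Posz i - 1)%R); first exact/IH/ltnW.
    apply: functional_extensionality => j; rewrite /slide /upd.
    by case: eqP => // _; rewrite eqxx /= /dir; congr pair; lia.
have -> : 2 * size w + 3 = 1 + (2 * size w + 1 + 1) by lia.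
apply: ExecSeq; first exact: ExecMove.
have -> : slide s k (dir false) = upd s k (w, Posz (size w) - 1)%R.
  by rewrite /slide sk.
apply: ExecSeq; first exact: bac.
have -> : upd s k (w, 0%R) = slide (upd s k (w, -1)%R) k (dir true).
  by apply: functional_extensionality => j; rewrite /slide /upd eqxx; case: eqP.
exact: ExecMove.
Qed.

Definition make (k : nat) p := Seq p (rewind k).

Lemma exec_make k p s u T :
  s k = ([::], 0%R) -> blank \notin u -> emits p s k u T ->
  exists2 t, t <= T + 2 * size u + 3 & exec (make k p) s (upd s k (u, 0%R)) t.
Proof.
move=> sk bu /emits_exec[t lt e]; exists (t + (2 * size u + 3)).
  by rewrite addnA !leq_add2r.
apply: ExecSeq e _.
have -> : upd s k (u, 0%R) = upd (emit s k u) k (u, 0%R).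
  by apply: functional_extensionality => j; rewrite /upd /emit /upd; case: eqP.
by apply: exec_rewind => //; rewrite /emit /upd eqxx sk.
Qed.

Definition put (k : nat) (c : A) : prog A := Append k (fun=> c).

Lemma emits_put s k c : (s k).2 = Posz (size (s k).1) ->
  emits (put k c) s k [:: c] 1.
Proof. by move=> e; apply: emits_append. Qed.

Variable one : A.
Hypothesis one_blank : one != blank.

(** As tapes are never erased, each power of the length gets a tape of its own, printed by a double
    loop over the previous power and [src]. *)
Fixpoint power (src base d : nat) : prog A :=
  if d is d'.+1 then
    Seq (power src base d')
      (make (base + d'.+1)
        (foreach (base + d') [::] (foreach src [::] (put (base + d'.+1) one))))
  else make base (put base one).

Fixpoint power_cost (d n : nat) : nat :=
  if d is d'.+1 then
    power_cost d' n + (n ^ d' * (n * 5 + 8) + 4 + 2 * n ^ d + 3)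
  else 6.

Lemma blank_nseq a : blank \notin nseq a one.
Proof. by rewrite mem_nseq negb_and eq_sym one_blank orbT. Qed.

Lemma exec_power src base d s w :
  s src = (w, 0%R) -> blank \notin w -> src < base ->
  (forall i, i <= d -> s (base + i) = ([::], 0%R)) ->
  exists s' t, [/\ exec (power src base d) s s' t,
     t <= power_cost d (size w),
     s' (base + d) = (nseq (size w ^ d) one, 0%R)
   & forall j, (j < base) || (base + d < j) -> s' j = s j].
Proof.
move=> ssrc bw lt; elim: d => [|d IH] free.
  have s0 := free 0 isT; rewrite addn0 in s0.
  have [||| t lt1 e] := @exec_make base (put base one) s [:: one] 1.
  - exact: s0.
  - exact: (blank_nseq 1).
  - by apply: emits_put; rewrite s0.
  exists (upd s base ([:: one], 0%R)), t; split=> //=.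
    by rewrite addn0 /upd eqxx.
  by move=> j H; rewrite /upd ifN //; lia.
have [i le|s1 [t1 [e1 l1 E1 F1]]] := IH.
  by apply: free; rewrite ltnW.
have srcb : src != base + d.+1 by lia.
have s1n : s1 (base + d.+1) = ([::], 0%R) by rewrite F1 ?free //; lia.
have s1s : s1 src = (w, 0%R) by rewrite F1 ?ssrc // lt.
have Em : emits (foreach (base + d) [::] (foreach src [::] (put (base + d.+1) one)))
    s1 (base + d.+1) (nseq (size w ^ d.+1) one)
    (size w ^ d * (size w * 5 + 8) + 4).
  have := @emits_foreach (base + d) [::] (foreach src [::] (put (base + d.+1) one))
    s1 (base + d.+1) _ (fun=> nseq (size w) one) (size w * 5 + 4) E1 (blank_nseq _).
  rewrite flatten_nseq size_nseq -expnSr muln0 addn0 -addnA; apply=> //.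
    by rewrite eqn_add2l; lia.
  move=> i _.
  have := @emits_foreach src [::] (put (base + d.+1) one)
    (slides [:: (base + d, true)] i s1) (base + d.+1) w (fun=> nseq 1 one) 1.
  rewrite flatten_nseq muln1; apply=> //.
    have o : offset [:: (base + d, true)] src = 0%R by rewrite /= ifN //; lia.
    by rewrite /slides s1s o GRing.mulr0.
  move=> i' _; apply: emits_put; rewrite /slides /= s1n /=.
  by rewrite !ifN ?GRing.addr0 ?GRing.mulr0 //; lia.
have [t2 l2 e2] := exec_make s1n (blank_nseq _) Em.
exists (upd s1 (base + d.+1) (nseq (size w ^ d.+1) one, 0%R)), (t1 + t2); split.
- exact: ExecSeq e1 e2.
- by rewrite /= leq_add // (leq_trans l2) // size_nseq.
- by rewrite /upd eqxx.
- by move=> j H; rewrite /upd ifN ?F1 //; lia.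
Qed.

(** The factor and the summand [c] are unrolled into the program text; only the power of the length
    is looped over. *)
Definition write_polynomial (src base dst c d : nat) : prog A :=
  Seq (power src base d)
    (make dst (Seq (seqs (fun=> foreach (base + d) [::] (put dst one)) (iota 0 c))
                   (seqs (fun=> put dst one) (iota 0 c)))).

Definition polynomial_cost (c d n : nat) : nat :=
  power_cost d n + (c * (n ^ d * 5 + 4) + 1 + (c + 1) + 2 * (c * n ^ d + c) + 3).

Lemma exec_write_polynomial src base dst c d s w :
  s src = (w, 0%R) -> blank \notin w -> src < base -> dst < base -> dst != src ->
  (forall i, i <= d -> s (base + i) = ([::], 0%R)) -> s dst = ([::], 0%R) ->
  exists s' t, [/\ exec (write_polynomial src base dst c d) s s' t,
     t <= polynomial_cost c d (size w),
     s' dst = (nseq (c * size w ^ d + c) one, 0%R)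
   & forall j, (j < base) && (j != dst) || (base + d < j) -> s' j = s j].
Proof.
move=> ssrc bw lts ltd ne free sd.
have [s1 [t1 [e1 l1 E1 F1]]] := exec_power ssrc bw lts free.
have s1d : s1 dst = ([::], 0%R) by rewrite F1 ?sd ?ltd.
have Em : emits (Seq (seqs (fun=> foreach (base + d) [::] (put dst one)) (iota 0 c))
                     (seqs (fun=> put dst one) (iota 0 c)))
    s1 dst (nseq (c * size w ^ d + c) one)
    (c * (size w ^ d * 5 + 4) + 1 + (c * 1 + 1)).
  rewrite nseqD; apply: emits_seq.
    rewrite -flatten_nseq -{3}(size_iota 0 c); apply: emits_seqs => x _.
    have := @emits_foreach (base + d) [::] (put dst one) s1 dst _ (fun=> nseq 1 one)
      1 E1 (blank_nseq _).
    rewrite flatten_nseq size_nseq muln1; apply=> //; first by lia.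
    move=> i' _; apply: emits_put; rewrite /slides /= s1d /=.
    by rewrite !ifN ?GRing.addr0 ?GRing.mulr0 //; lia.
  rewrite -{2}(muln1 c) -flatten_nseq -{3}(size_iota 0 c); apply: emits_seqs => x _.
  by apply: emits_put; rewrite s1d.
have [t2 l2 e2] := exec_make s1d (blank_nseq _) Em.
exists (upd s1 dst (nseq (c * size w ^ d + c) one, 0%R)), (t1 + t2); split.
- exact: ExecSeq e1 e2.
- by rewrite leq_add // (leq_trans l2) // size_nseq muln1.
- by rewrite /upd eqxx.
- by move=> j H; rewrite /upd ifN ?F1 //; lia.
Qed.

End Loops.

Lemma flatten_mkseq (T U : Type) (x0 : T) (F : T -> seq U) (w : seq T) :
  flatten (mkseq (fun i => F (nth x0 w i)) (size w)) = flatten (map F w).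
Proof. by rewrite -{3}(mkseq_nth x0 w) /mkseq -map_comp. Qed.

Lemma flatten_mkseq1 (T : Type) (x0 : T) (w : seq T) :
  flatten (mkseq (fun i => [:: nth x0 w i]) (size w)) = w.
Proof. by rewrite (flatten_mkseq x0 (fun y => [:: y])); elim: w => //= y w ->. Qed.

Section MoreLoops.
Variables (A : finType) (blank : A).
Implicit Types (s : tapes A).
Local Notation emits := (emits blank).

Lemma slides_other l i s j : offset l j = 0%R -> @slides A l i s j = s j.
Proof. by move=> o; rewrite /slides o GRing.mulr0 GRing.addr0; case: (s j). Qed.

Lemma reading_emit s k v j : j != k -> readings blank (emit s k v) j = readings blank s j.
Proof. by move=> ne; rewrite /readings /emit /upd (negPf ne). Qed.

Definition puts (k : nat) (l : seq A) : prog A := seqs (put k) l.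

Lemma emits_puts s k l : (s k).2 = Posz (size (s k).1) ->
  emits (puts k l) s k l (size l + 1).
Proof.
move=> e; have := @emits_seqs A blank A (put k) l s k (fun c => [:: c]) 1.
rewrite muln1 (_ : flatten _ = l); last by elim: l => //= c l ->.
by apply=> c _; apply: emits_put.
Qed.

Lemma emits_foreach_puts j s k w l :
  s j = (w, 0%R) -> blank \notin w -> j != k -> (s k).2 = Posz (size (s k).1) ->
  emits (foreach j [::] (puts k l)) s k (flatten (nseq (size w) l))
    (size w * (size l + 5) + 4).
Proof.
move=> sj bw jk e.
have := @emits_foreach A blank j [::] (puts k l) s k w (fun=> l) (size l + 1) sj bw jk erefl.
rewrite muln0 addn0 -addnA (_ : mkseq _ _ = nseq (size w) l); last first.
  by rewrite /mkseq; elim: (size w) 0 => //= n IH i; rewrite IH.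
apply=> i _; apply: emits_puts; rewrite slides_other //=.
by rewrite eq_sym (negPf jk).
Qed.

Lemma emits_loop j l p s k w n h T :
  s j = (w, 0%R) -> blank \notin w -> size w = n -> j != k -> offset l j = 0%R ->
  (forall i, i < n -> emits p (slides ((j, true) :: l) (Posz i) s) k (h i) T) ->
  emits (foreach j l p) s k (flatten (mkseq h n)) (n * (T + 2 * size l + 4) + 4).
Proof. by move=> sj bw <- jk o H; apply: emits_foreach. Qed.

Lemma bounded_seqs (X : Type) (P : X -> prog A) l K :
  (forall x, bounded_by K (P x)) -> bounded_by K (seqs P l).
Proof. by move=> H; elim: l => //= x l ->; rewrite H. Qed.

Lemma bounded_seq (p q : prog A) K :
  bounded_by K p -> bounded_by K q -> bounded_by K (Seq p q).
Proof. by move=> /= -> ->. Qed.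

Lemma bounded_moves i l K :
  i.1 <= K -> all (fun i => i.1 <= K) l -> bounded_by K (moves A i l).
Proof. by elim: l i => //= i' l IH i -> /andP[li' ll] /=; apply: IH. Qed.

Lemma bounded_foreach j l (p : prog A) K :
  j <= K -> all (fun i => i.1 <= K) l -> bounded_by K p -> bounded_by K (foreach j l p).
Proof.
move=> lj ll bp; apply: bounded_seq; first by rewrite /= lj bp bounded_moves.
by rewrite /= lj bounded_moves // all_map.
Qed.

Lemma bounded_make k (p : prog A) K : k <= K -> bounded_by K p -> bounded_by K (make k p).
Proof. by move=> /= -> ->. Qed.

Lemma bounded_puts k (l : seq A) K : k <= K -> bounded_by K (puts k l).
Proof. by move=> le; apply: bounded_seqs. Qed.

Lemma bounded_write_power (one : A) src base d K :
  src <= K -> base + d <= K -> bounded_by K (power one src base d).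
Proof.
move=> ls; elim: d => [|d IH] lb; first by rewrite addn0 in lb; apply: bounded_make.
apply: bounded_seq; first by apply: IH; lia.
apply: bounded_make => //; apply: bounded_foreach => //; first by lia.
by apply: bounded_foreach.
Qed.

Lemma bounded_write_polynomial (one : A) src base dst c d K :
  src <= K -> dst <= K -> base + d <= K ->
  bounded_by K (write_polynomial one src base dst c d).
Proof.
move=> ls ld lb; apply: bounded_seq; first exact: bounded_write_power.
apply: bounded_make => //; apply: bounded_seq; apply: bounded_seqs => _ //.
exact: bounded_foreach.
Qed.

End MoreLoops.

(** * Polynomially bounded functions *)

(** The base [n.+1] is positive, so that enlarging the exponent never lowers the bound; this makes
    closure under sums immediate. *)
Definition poly_bounded (f : nat -> nat) : Prop :=
  exists c d, forall n, f n <= c * n.+1 ^ d.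

Lemma poly_bounded_const c : poly_bounded (fun=> c).
Proof. by exists c, 0 => n; rewrite expn0 muln1. Qed.

Lemma poly_bounded_id : poly_bounded id.
Proof. by exists 1, 1 => n; rewrite expn1 mul1n. Qed.

Lemma poly_bounded_add f g :
  poly_bounded f -> poly_bounded g -> poly_bounded (fun n => f n + g n).
Proof.
move=> [c [d H]] [c' [d' H']]; exists (c + c'), (d + d') => n; rewrite mulnDl.
apply: leq_add; [apply: leq_trans (H n) _ | apply: leq_trans (H' n) _];
  by rewrite leq_mul2l leq_pexp2l ?leq_addr ?leq_addl ?orbT.
Qed.

Lemma poly_bounded_mul f g :
  poly_bounded f -> poly_bounded g -> poly_bounded (fun n => f n * g n).
Proof.
move=> [c [d H]] [c' [d' H']]; exists (c * c'), (d + d') => n.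
by rewrite expnD mulnACA leq_mul.
Qed.

Lemma poly_bounded_exp f d :
  poly_bounded f -> poly_bounded (fun n => f n ^ d).
Proof.
move=> pf; elim: d => [|d IH].
  by exists 1, 0 => n; rewrite !expn0.
have [c [e H]] := poly_bounded_mul pf IH.
by exists c, e => n; rewrite expnS.
Qed.

(** For positive [n] one has [n.+1 <= 2 * n], whence the factor [2 ^ d]; at [n = 0] the additive
    constant does the work. *)
Lemma poly_boundedP f : poly_bounded f ->
  exists c d, forall n, f n <= c * n ^ d + c.
Proof.
move=> [c [d H]]; exists (c * 2 ^ d), d => n; apply: leq_trans (H n) _.
case: n => [|n]; first by rewrite exp1n muln1 (leq_trans _ (leq_addl _ _)) // leq_pmulr ?expn_gt0.
rewrite -mulnA -expnMn (leq_trans _ (leq_addr _ _)) // leq_mul2l.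
by case: d {H} => [|d]; rewrite ?expn0 ?leq_exp2r ?orbT //; apply/orP; right; lia.
Qed.

(** * The gadget *)

(* The tile [i] is chosen in a cell when [Clause i] is inactive at time [Select i].
   The vertices [Relay b i k], for increasing [k], are then inactive at the times
   [Signal b i k]. [Conflict b i j] forbids the tile [j] in its own cell next to the
   tile [i] in the previous cell ([b = false]) or in the cell above ([b = true]). *)
Inductive main_vertex (m : nat) :=
| Clause of 'I_m
| Relay of bool & 'I_m & 'I_m
| Conflict of bool & 'I_m & 'I_m.

(** Every main vertex owns a private complete graph of [Dead] vertices, which keeps their degree
    bounded. The dummies only carry the star with four edges. *)
Inductive vertex (m : nat) :=
| Main of main_vertex m
| Dead of main_vertex m & 'I_5
| Dummy of 'I_5.

Arguments Dummy {m}.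

(** The snapshots of one cell. [Link] runs along the chain of clauses, [Signal] along a chain of
    relays and on to the conflict vertices. [Forced v] is the edge to an exhausted vertex that
    consumes one point of [v]; among the clauses only the first has it. *)
Inductive time (m : nat) :=
| Link of 'I_m
| Forced of main_vertex m
| Select of 'I_m
| Signal of bool & 'I_m & 'I_m
| Drain of main_vertex m & 'I_5 & bool
| Star.

Arguments Star {m}.

Section Finiteness.
Variable m : nat.

Definition main_code (v : main_vertex m) :
    'I_m + (bool * 'I_m * 'I_m + bool * 'I_m * 'I_m) :=
  match v with
  | Clause i => inl i
  | Relay b i j => inr (inl (b, i, j))
  | Conflict b i j => inr (inr (b, i, j))
  end.

Definition main_decode x : main_vertex m :=
  match x with
  | inl i => Clause i
  | inr (inl (b, i, j)) => Relay b i j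
  | inr (inr (b, i, j)) => Conflict b i j
  end.

Lemma main_codeK : cancel main_code main_decode.
Proof. by case. Qed.

HB.instance Definition _ := Finite.copy (main_vertex m) (can_type main_codeK).

Definition vertex_code (v : vertex m) : main_vertex m + (main_vertex m * 'I_5 + 'I_5) :=
  match v with
  | Main v => inl v
  | Dead v i => inr (inl (v, i))
  | Dummy i => inr (inr i)
  end.

Definition vertex_decode x : vertex m :=
  match x with
  | inl v => Main v
  | inr (inl (v, i)) => Dead v i
  | inr (inr i) => Dummy i
  end.

Lemma vertex_codeK : cancel vertex_code vertex_decode.
Proof. by case. Qed.

HB.instance Definition _ := Finite.copy (vertex m) (can_type vertex_codeK).

Definition time_code (t : time m) :
    'I_m + (main_vertex m + ('I_m + (bool * 'I_m * 'I_m
      + (main_vertex m * 'I_5 * bool + unit)))) :=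
  match t with
  | Link i => inl i
  | Forced v => inr (inl v)
  | Select i => inr (inr (inl i))
  | Signal b i j => inr (inr (inr (inl (b, i, j))))
  | Drain v i b => inr (inr (inr (inr (inl (v, i, b)))))
  | Star => inr (inr (inr (inr (inr tt))))
  end.

Definition time_decode x : time m :=
  match x with
  | inl i => Link i
  | inr (inl v) => Forced v
  | inr (inr (inl i)) => Select i
  | inr (inr (inr (inl (b, i, j)))) => Signal b i j
  | inr (inr (inr (inr (inl (v, i, b))))) => Drain v i b
  | inr (inr (inr (inr (inr tt)))) => Star
  end.

Lemma time_codeK : cancel time_code time_decode.
Proof. by case. Qed.

HB.instance Definition _ := Finite.copy (time m) (can_type time_codeK).

End Finiteness.

Section LocalEdges.
Variables (m : nat) (conflict : bool -> rel 'I_m).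

Definition onext (i : 'I_m) : option 'I_m := insub i.+1.

Definition opred (i : 'I_m) : 'I_m := Ordinal (leq_ltn_trans (leq_pred i) (ltn_ord i)).

Definition ofirst (i : 'I_m) : 'I_m := Ordinal (leq_ltn_trans (leq0n i) (ltn_ord i)).

(** Two distinct residues modulo 5 differ by 1 or 2 in exactly one orientation, so these ten arcs
    are the edges of the complete graph, each once. *)
Definition drain_head (i : 'I_5) (b : bool) : 'I_5 := inZp (i + (if b then 1 else 2)).

(* An edge [(u, (r, v))] joins [u] in the cell owning the snapshot to [v] in the
   same cell ([r = None]), in the next cell of the row ([r = Some false]) or in
   the next row ([r = Some true]). *)
Definition local_edges (forbidden : pred 'I_m) (t : time m) :
    seq (vertex m * (option bool * vertex m)) :=
  match t with
  | Link i => [:: (Main (Clause i), (None,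
        if onext i is Some j then Main (Clause j) else Dead (Clause i) (inZp 1)))]
  | Forced v =>
      if (if v is Clause i then i == 0 :> nat else true)
      then [:: (Main v, (None, Dead v (inZp 0)))] else [::]
  | Select i =>
      [:: (Main (Clause i), (None, Main (Relay false i (ofirst i))));
          (Main (Clause i), (None, Main (Relay true i (ofirst i))))] ++
      nseq (forbidden i) (Main (Clause i), (None, Dead (Clause i) (inZp 2)))
  | Signal b i k =>
      (if onext k is Some k'
       then [:: (Main (Relay b i k), (None, Main (Relay b i k')))] else [::]) ++
      nseq (conflict b i k) (Main (Relay b i k), (Some b, Main (Conflict b i k))) ++
      nseq (conflict b k i) (Main (Relay b i k), (None, Main (Conflict b k i)))
  | Drain v i b => [:: (Dead v i, (None, Dead v (drain_head i b)))]
  | Star => [seq (Dummy (inZp 0), (None, Dummy (inZp j))) | j <- iota 1 4]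
  end.

(** Reading the snapshot off the two ends is what shows that no edge occurs twice. It also explains
    why a clause meets the [Dead] vertices 0, 1 and 2 at [Forced], [Link] and [Select]: with a
    single one of them these would be the same edge. *)
Definition edge_time (u v : vertex m) : option (time m) :=
  match u, v with
  | Main (Clause i), Main (Clause j) => if j == i.+1 :> nat then Some (Link i) else None
  | Main (Clause i), Main (Relay _ _ _) => Some (Select i)
  | Main (Relay b i k), Main (Relay _ _ k') =>
      if k' == k.+1 :> nat then Some (Signal b i k) else None
  | Main (Relay b i k), Main (Conflict _ _ _) => Some (Signal b i k)
  | Main v, Dead _ j =>
      match v with
      | Clause i => if j == 0 :> nat then Some (Forced v)
                    else if j == 1 :> nat then Some (Link i) else Some (Select i)
      | _ => Some (Forced v)
      end
  | Dead v i, Dead _ j =>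
      if j == drain_head i true then Some (Drain v i true)
      else if j == drain_head i false then Some (Drain v i false) else None
  | Dummy i, Dummy j => if i == 0 :> nat then Some Star else None
  | _, _ => None
  end.

Lemma onextP (i j : 'I_m) : onext i = Some j -> j = i.+1 :> nat.
Proof. by rewrite /onext; case: insubP => // k _ <- [->]. Qed.

Lemma onext_None (i : 'I_m) : onext i = None -> i.+1 = m.
Proof. by rewrite /onext; case: insubP => // H _; have := ltn_ord i; lia. Qed.

Lemma opredK (k : 'I_m) : 0 < k -> onext (opred k) = Some k.
Proof.
move=> k0; rewrite /onext; case: insubP => [j _ /=|]; rewrite /= prednK ?ltn_ord //.
by move=> E; congr Some; apply: val_inj.
Qed.

Lemma onext_opred (k j : 'I_m) : onext k = Some j -> (j != 0 :> nat) /\ opred j = k.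
Proof. by move/onextP => E; split; [lia | apply: val_inj; rewrite /= E]. Qed.

(** Edges are listed with an orientation. The second half excludes that a pair is listed in both
    directions, and also that an edge is a loop. *)
Lemma edge_timeP F t u r v : (u, (r, v)) \in local_edges F t ->
  edge_time u v = Some t /\ edge_time v u = None.
Proof.
case: t => [i|w|i|b i k|w i b|] /=.
- rewrite inE; case E: (onext i) => [j|] /eqP[-> _ ->] //=.
  by rewrite (onextP E) eqxx; split => //; rewrite ifN //; lia.
- by case: w => [i|b i j|b i j] /=; try case: ifP => // _; rewrite inE => /eqP[-> _ ->].
- by rewrite !inE => /orP[/eqP[-> _ ->]|/orP[/eqP[-> _ ->]|]] //; case: (F i) => //;
    rewrite inE => /eqP[-> _ ->].
- rewrite !mem_cat => /orP[|/orP[]].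
  + case E: (onext k) => [j|] //; rewrite inE => /eqP[-> _ ->] /=.
    by rewrite (onextP E) eqxx; split => //; rewrite ifN //; lia.
  + by case: (conflict b i k) => //; rewrite inE => /eqP[-> _ ->].
  + by case: (conflict b k i) => //; rewrite inE => /eqP[-> _ ->].
- rewrite inE => /eqP[-> _ ->] /=.
  by case: b; case: i => [[|[|[|[|[|]]]]] //=].
- by rewrite !inE => /or4P[] /eqP[-> _ ->].
Qed.

Lemma size_local_edges F t : size (local_edges F t) <= 4.
Proof.
case: t => [i|w|i|b i k|w i b|] //=.
- by case: ifP.
- by case: (F i).
- by rewrite !size_cat !size_nseq; case: (onext k) => [?|]; case: conflict; case: conflict.
Qed.

End LocalEdges.

(* A linear form of the bounded tiling problem: the cells 0, ..., cells - 1 are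
   read row by row, [width] cells per row. *)
Definition is_tiling (m : nat) (conflict : bool -> rel 'I_m) (width cells : nat)
    (forbidden : nat -> pred 'I_m) (tau : nat -> 'I_m) : Prop :=
  forall p, p < cells ->
    ~~ forbidden p (tau p) /\
    forall b, p + (if b then width else 1) < cells ->
      ~~ conflict b (tau p) (tau (p + (if b then width else 1))).

Section Gadget.
Variables (m : nat) (conflict : bool -> rel 'I_m) (width cells : nat).
Variable forbidden : nat -> pred 'I_m.
Hypothesis width_gt0 : 0 < width.

Definition gap (b : bool) : nat := if b then width else 1.

Lemma gap_gt0 b : 0 < gap b. Proof. by case: b. Qed.

Definition rel_cell (r : option bool) (q : nat) : nat := if r is Some b then q + gap b else q.

Definition gvertex := (nat * vertex m)%type.
Definition gtime := (nat * time m)%type.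

Definition gedge (t : gtime) (u v : gvertex) : bool :=
  (u.1 == t.1) && has (fun e => [&& e.1 == u.2, rel_cell e.2.1 t.1 == v.1 & e.2.2 == v.2])
                      (local_edges conflict (forbidden t.1) t.2).

Lemma gedgeP t u v : gedge t u v -> exists r,
  [/\ u.1 = t.1, v.1 = rel_cell r t.1
    & (u.2, (r, v.2)) \in local_edges conflict (forbidden t.1) t.2].
Proof.
case/andP=> /eqP-> /hasP[[u2 [r v2]] /= H /and3P[/eqP <- /eqP <- /eqP <-]].
by exists r.
Qed.

Lemma gedgeI q t u r v :
  (u, (r, v)) \in local_edges conflict (forbidden q) t ->
  gedge (q, t) (q, u) (rel_cell r q, v).
Proof. by move=> H; rewrite /gedge /= eqxx; apply/hasP; exists (u, (r, v)); rewrite //= !eqxx. Qed.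

(** * A covering timeline yields a tiling *)

Section Soundness.
Variable act : gvertex -> gtime -> bool.
Hypothesis capacity : forall v ts, v.1 < cells -> uniq ts -> count (act v) ts <= 2.
Hypothesis covers : forall t u v,
  t.1 < cells -> v.1 < cells -> gedge t u v -> act u t || act v t.

Lemma capacity3 v t1 t2 t3 : v.1 < cells -> t1 <> t2 -> t1 <> t3 -> t2 <> t3 ->
  act v t1 -> act v t2 -> act v t3 = false.
Proof.
move=> lt /eqP n12 /eqP n13 /eqP n23 a1 a2; have := @capacity v [:: t1; t2; t3] lt.
rewrite /= a1 a2 !inE negb_or n12 n13 n23; case: (act v t3) => // H.
by have := H isT.
Qed.

(* Ten edges of a complete graph on five vertices, in ten snapshots of their own,
   use up the total capacity of its vertices. *)
Lemma complete5_exhausted (x : nat -> nat -> bool -> nat) (y : nat -> nat) :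
  (forall k b, k < 5 -> 1 <= x k k b + x ((k + (if b then 1 else 2)) %% 5) k b) ->
  (forall k, k < 5 -> x k k true + x k k false + x k ((k + 4) %% 5) true
     + x k ((k + 3) %% 5) false + y k <= 2) ->
  forall k, k < 5 -> y k = 0.
Proof.
move=> cov cap.
have c0 : 1 <= x 0 0 true + x 1 0 true := cov 0 true isT.
have c1 : 1 <= x 1 1 true + x 2 1 true := cov 1 true isT.
have c2 : 1 <= x 2 2 true + x 3 2 true := cov 2 true isT.
have c3 : 1 <= x 3 3 true + x 4 3 true := cov 3 true isT.
have c4 : 1 <= x 4 4 true + x 0 4 true := cov 4 true isT.
have d0 : 1 <= x 0 0 false + x 2 0 false := cov 0 false isT.
have d1 : 1 <= x 1 1 false + x 3 1 false := cov 1 false isT.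
have d2 : 1 <= x 2 2 false + x 4 2 false := cov 2 false isT.
have d3 : 1 <= x 3 3 false + x 0 3 false := cov 3 false isT.
have d4 : 1 <= x 4 4 false + x 1 4 false := cov 4 false isT.
have e0 : x 0 0 true + x 0 0 false + x 0 4 true + x 0 3 false + y 0 <= 2 := cap 0 isT.
have e1 : x 1 1 true + x 1 1 false + x 1 0 true + x 1 4 false + y 1 <= 2 := cap 1 isT.
have e2 : x 2 2 true + x 2 2 false + x 2 1 true + x 2 0 false + y 2 <= 2 := cap 2 isT.
have e3 : x 3 3 true + x 3 3 false + x 3 2 true + x 3 1 false + y 3 <= 2 := cap 3 isT.
have e4 : x 4 4 true + x 4 4 false + x 4 3 true + x 4 2 false + y 4 <= 2 := cap 4 isT.
(* The ten edges need ten units and the five vertices have ten in all, so nothing is left for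
   [y]. *)
have sum : y 0 + y 1 + y 2 + y 3 + y 4 = 0 by clear cov cap; lia.
by move=> k lt; move: k lt sum => [|[|[|[|[|]]]]] //; clear; lia.
Qed.

Lemma dead_inactive p w i t : p < cells -> (forall j b, t <> (p, Drain w j b)) ->
  act (p, Dead w i) t = false.
Proof.
move=> lt nt.
pose D k : gvertex := (p, Dead w (inZp k)).
pose T k b : gtime := (p, Drain w (inZp k) b).
have -> : (p, Dead w i) = D i by congr (_, Dead _ _); apply: val_inj; rewrite /= modn_small.
apply: negbTE; rewrite -eqb0; apply/eqP.
apply: (@complete5_exhausted (fun k l b => act (D k) (T l b)) (fun k => act (D k) t)) => //.
  move=> k b lt5; have := @covers (T k b) (D k) (D ((k + (if b then 1 else 2)) %% 5)) lt lt.
  case: (act (D k) _) => // H; rewrite add0n lt0b.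
  apply: H; apply: (@gedgeI p _ _ None); rewrite /= inE /D /=.
  apply/eqP; congr (_, (_, Dead _ _)); apply: val_inj => /=.
  by case: b; rewrite modn_mod modnDml.
move=> k lt5.
(* Modulo 5, [k + 4] and [k + 3] are [k - 1] and [k - 2], the tails of the two arcs arriving at [k].
   Together with [t] these are five distinct snapshots. *)
have := @capacity (D k) (rcons [seq T x.1 x.2 | x <-
  [:: (k, true); (k, false); ((k + 4) %% 5, true); ((k + 3) %% 5, false)]] t) lt.
rewrite /= !addn0 !addnA; apply.
have nT x b : (T x b == t) = false by apply/eqP => E; apply: (nt (inZp x) b).
have TT x y b b' : (T x b == T y b') = (x == y %[mod 5]) && (b == b').
  by apply/eqP/andP => [[/eqP E ->]|[/eqP E /eqP ->]] //; congr (_, Drain _ _ _); apply: val_inj.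
rewrite !inE !nT !TT /= !andbF ?andbT ?orbF !modn_mod.
by rewrite -{1 3}[k]addn0 !eqn_modDl.
Qed.

Lemma forced_active p w : p < cells -> (if w is Clause i then i == 0 :> nat else true) ->
  act (p, Main w) (p, Forced w).
Proof.
move=> lt H; have := @covers (p, Forced w) (p, Main w) (p, Dead w (inZp 0)) lt lt.
rewrite (@dead_inactive p w) ?orbF //; apply.
by apply: (@gedgeI p _ _ None); rewrite /= H inE.
Qed.

(** Induction along the chain: relay [k] is needed at its [Forced] snapshot and at the one in which
    its predecessor is inactive, which leaves nothing for its own [Signal]. *)
Lemma relay_inactive p i b k : p < cells ->
  ~~ act (p, Main (Clause i)) (p, Select i) ->
  act (p, Main (Relay b i k)) (p, Signal b i k) = false.
Proof.
move=> lt n; case: k => k ltk; elim: k ltk => [|k IH] ltk.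
  apply: (@capacity3 _ (p, Select i) (p, Forced (Relay b i (Ordinal ltk)))) => //; last exact: forced_active.
  have := @covers (p, Select i) (p, Main (Clause i)) (p, Main (Relay b i (Ordinal ltk))) lt lt.
  rewrite (negPf n) /=; apply; apply: (@gedgeI p _ _ None).
  rewrite (_ : Ordinal ltk = ofirst i); last exact: val_inj.
  by case: b; rewrite /= !inE eqxx ?orbT.
set k1 := Ordinal ltk; have E : onext (opred k1) = Some k1 by apply: opredK.
have := IH (ltnW ltk); rewrite (_ : Ordinal _ = opred k1); last exact: val_inj.
move=> n1.
apply: (@capacity3 _ (p, Signal b i (opred k1)) (p, Forced (Relay b i k1))) => //; last exact: forced_active.
  by move=> -[] /=; lia.
have := @covers (p, Signal b i (opred k1)) (p, Main (Relay b i (opred k1)))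
  (p, Main (Relay b i k1)) lt lt.
rewrite n1 /=; apply; apply: (@gedgeI p _ _ None).
by rewrite /= E inE eqxx.
Qed.

(** If every clause were active at [Select], the first one, being forced, would be inactive at its
    [Link]; this forces the next clause there, hence makes it inactive at its own [Link], and so on.
    The last [Link] ends in an exhausted vertex and would stay uncovered. *)
Lemma some_selected p : 0 < m -> p < cells ->
  exists i, ~~ act (p, Main (Clause i)) (p, Select i).
Proof.
move=> m0 lt; apply/existsP; apply: contraT; rewrite negb_exists => /forallP H.
have {}H i : act (p, Main (Clause i)) (p, Select i) by have := H i; rewrite negbK.
have L i : act (p, Main (Clause i)) (p, Link i) = false.
  case: i => i lti; elim: i lti => [|i IH] lti.
    by apply: (@capacity3 _ (p, Select (Ordinal lti)) (p, Forced (Clause (Ordinal lti)))) => //; exact: forced_active.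
  set i1 := Ordinal lti; have E : onext (opred i1) = Some i1 by apply: opredK.
  have := IH (ltnW lti); rewrite (_ : Ordinal _ = opred i1); last exact: val_inj.
  move=> n1; apply: (@capacity3 _ (p, Select i1) (p, Link (opred i1))) => //.
    by move=> -[] /=; lia.
  have := @covers (p, Link (opred i1)) (p, Main (Clause (opred i1))) (p, Main (Clause i1)) lt lt.
  by rewrite n1 /=; apply; apply: (@gedgeI p _ _ None); rewrite /= E inE eqxx.
have ltm : m.-1 < m by lia.
set i := Ordinal ltm.
have E : onext i = None by rewrite /onext insubN //= prednK // ltnn.
have := @covers (p, Link i) (p, Main (Clause i)) (p, Dead (Clause i) (inZp 1)) lt lt.
rewrite L (@dead_inactive p) //=; apply.
by apply: (@gedgeI p _ _ None); rewrite /= E inE eqxx.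
Qed.

(** If the tiles [i] and [j] of neighbouring cells were in conflict, the vertex [Conflict b i j]
    would be needed at three snapshots: its [Forced] one and a signal from each of the two cells. *)
Lemma tiling_of_cover : 0 < m ->
  exists tau, is_tiling conflict width cells forbidden tau.
Proof.
move=> m0; pose tau p := odflt (Ordinal m0)
  [pick i | ~~ act (p, Main (Clause i)) (p, Select i)].
have tauP p : p < cells -> ~~ act (p, Main (Clause (tau p))) (p, Select (tau p)).
  move=> lt; rewrite /tau; case: pickP => //= H.
  by have [i] := some_selected m0 lt; rewrite H.
exists tau => p lt; split.
  apply: contraL (tauP p lt) => F; rewrite negbK.
  have := @covers (p, Select (tau p)) (p, Main (Clause (tau p)))
    (p, Dead (Clause (tau p)) (inZp 2)) lt lt.
  rewrite (@dead_inactive p) ?orbF //; apply.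
  by apply: (@gedgeI p _ _ None); rewrite /= F !inE eqxx !orbT.
move=> b; rewrite -/(gap b) => lt'; apply/negP => C.
set i := tau p in C; set j := tau (p + gap b) in C.
pose w : gvertex := (p + gap b, Main (Conflict b i j)).
have a1 : act w (p, Signal b i j).
  have := @covers (p, Signal b i j) (p, Main (Relay b i j)) w lt lt'.
  rewrite (@relay_inactive p) ?tauP //=; apply.
  apply: (@gedgeI p _ _ (Some b)).
  by rewrite /= C !mem_cat mem_nseq eqxx orbT.
have a2 : act w (p + gap b, Signal b j i).
  have := @covers (p + gap b, Signal b j i) (p + gap b, Main (Relay b j i)) w lt' lt'.
  rewrite (@relay_inactive (p + gap b)) ?tauP //=; apply.
  apply: (@gedgeI (p + gap b) _ _ None).
  by rewrite /= C !mem_cat !mem_nseq eqxx !orbT.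
have := @forced_active (p + gap b) (Conflict b i j) lt' isT.
rewrite (@capacity3 w (p, Signal b i j) (p + gap b, Signal b j i)) //.
by move=> -[E _]; have := gap_gt0 b; lia.
Qed.

End Soundness.

(** * A tiling yields a covering timeline *)

Section Completeness.
Variable tau : nat -> 'I_m.
Hypothesis tauP : is_tiling conflict width cells forbidden tau.

Definition link_in (i : 'I_m) : time m :=
  if i == 0 :> nat then Forced (Clause i) else Link (opred i).

Definition relay_in (b : bool) (i k : 'I_m) : time m :=
  if k == 0 :> nat then Select i else Signal b i (opred k).

Definition schedule (v : gvertex) : seq gtime :=
  let: (p, v) := v in
  match v with
  | Main (Clause i) =>
      if i < tau p then [:: (p, link_in i); (p, Select i)]
      else if i == tau p then [:: (p, link_in i); (p, Link i)]
      else [:: (p, Link i); (p, Select i)]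
  | Main (Relay b i k) =>
      [:: (p, Forced (Relay b i k));
          (p, if i == tau p then relay_in b i k else Signal b i k)]
  | Main (Conflict b i j) =>
      [:: (p, Forced (Conflict b i j));
          if j == tau p then (p, Signal b j i) else (p - gap b, Signal b i j)]
  | Dead w i => [:: (p, Drain w i true); (p, Drain w i false)]
  | Dummy _ => [:: (p, Star)]
  end.

Lemma size_schedule v : size (schedule v) <= 2.
Proof. by case: v => p [[i|b i k|b i j]|w i|i] //=; case: ltngtP => //; case: eqP. Qed.

Lemma schedule_covers t u v : t.1 < cells -> v.1 < cells -> gedge t u v ->
  (t \in schedule u) || (t \in schedule v).
Proof.
case: t u v => q t [p u] [p' v] /= lt lt' /gedgeP[r /= [Ep Ep' e]].
have [okF okC] := tauP lt; rewrite {}Ep {p}; rewrite Ep' {p' Ep'} in lt' *.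
case: t e => [i|w|i|b i k|w i b|] /=.
- rewrite inE; case E: (onext i) => [j|] /eqP[-> -> ->] /=; last first.
    (* The last clause cannot precede the chosen one, so it is active at its own [Link]. *)
    have := onext_None E; have := ltn_ord (tau q); have := ltn_ord i.
    case: (ltngtP i (tau q)) => [|gt|/val_inj ->] *; first lia.
      by rewrite ifN ?inE ?eqxx //; apply: contraTneq gt => ->; rewrite ltnn.
    by rewrite eqxx !inE eqxx orbT.
  case: (ltngtP i (tau q)) => [lti|gt|/val_inj ->]; last first.
  + by rewrite eqxx !inE eqxx orbT.
  + by rewrite ifN ?inE ?eqxx //; apply: contraTneq gt => ->; rewrite ltnn.
  + have [j0 Ej] := onext_opred E; have Eij := onextP E.
    rewrite /link_in (negPf j0) Ej; apply/orP; right.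
    case: ltngtP => [ltj|gt|/val_inj Ej']; first by rewrite inE eqxx.
      by lia.
    by rewrite Ej' eqxx inE eqxx.
- case: ifP => // cw; rewrite inE => /eqP[-> -> ->].
  case: w cw => [i /eqP i0|b i k _|b i j _] /=; try by rewrite inE eqxx.
  have -> : link_in i = Forced (Clause i) by rewrite /link_in i0.
  case: ltngtP => [|gt|/val_inj ->]; first by rewrite inE eqxx.
    by rewrite i0 in gt.
  by rewrite eqxx inE eqxx.
- have sel : i != tau q -> (q, Select i) \in schedule (q, Main (Clause i)).
    move=> ne /=; case: ltngtP => [|_|/val_inj E]; first by rewrite !inE eqxx orbT.
      by rewrite (negPf ne) !inE eqxx orbT.
    by rewrite E eqxx in ne.
  move=> H; case: (eqVneq i (tau q)) => [E|ne]; last first.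
    suff -> : u = Main (Clause i) by rewrite sel.
    by move: H; rewrite !inE => /or3P[|| /nseqP[]] => [/eqP[]|/eqP[]|[]].
  move: H; rewrite !inE => /or3P[/eqP[-> -> ->]|/eqP[-> -> ->]|/nseqP[]].
  + by rewrite /= -E eqxx !inE eqxx !orbT.
  + by rewrite /= -E eqxx !inE eqxx !orbT.
  + by rewrite E (negPf okF).
- move=> H; have Eu : u = Main (Relay b i k).
    move: H; rewrite !mem_cat => /or3P[|/nseqP[[-> //]]|/nseqP[[-> //]]].
    by case: (onext k) => // j; rewrite inE => /eqP[].
  case: (eqVneq i (tau q)) => [E|ne]; last first.
    by rewrite Eu /= (negPf ne) !inE eqxx orbT.
  rewrite !mem_cat in H; case/or3P: H.
  + case En: (onext k) => [j|] //; rewrite inE => /eqP[_ -> ->].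
    have [j0 Ej] := onext_opred En.
    by rewrite /= /relay_in -E eqxx (negPf j0) Ej !inE eqxx !orbT.
  + move=> /nseqP[[_ Er ->] C]; rewrite Er /= in lt' *.
    (* The signal comes from the earlier cell, whose tile is [i]. The tile of the later cell is not
       [k], by the tiling, so the conflict vertex has its second point free for this signal. *)
    have := okC b lt'; rewrite -E; case: eqVneq => [<-|_ _].
      by move: C; case: conflict.
    by rewrite addnK !inE eqxx !orbT.
  + by move=> /nseqP[[_ -> ->] C] /=; rewrite -E eqxx !inE eqxx !orbT.
- rewrite inE => /eqP[-> -> ->]; apply/orP; left.
  by case: b; rewrite /= !inE eqxx ?orbT.
- by rewrite !inE => /or4P[] /eqP[-> -> ->]; rewrite /= inE eqxx.
Qed.

End Completeness.

(** * Few snapshots per vertex, and a single snapshot per edge *)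

Definition occurrences (v : gvertex) : seq gtime :=
  let: (p, v) := v in
  match v with
  | Main (Clause i) => [:: (p, Forced (Clause i)); (p, Link (opred i)); (p, Link i); (p, Select i)]
  | Main (Relay b i k) =>
      [:: (p, Forced (Relay b i k)); (p, Select i); (p, Signal b i (opred k)); (p, Signal b i k)]
  | Main (Conflict b i j) =>
      [:: (p, Forced (Conflict b i j)); (p, Signal b j i); (p - gap b, Signal b i j)]
  | Dead w i =>
      (if w is Clause j then [:: (p, Link j); (p, Select j)] else [::]) ++
      [:: (p, Forced w); (p, Drain w i true); (p, Drain w i false);
          (p, Drain w (inZp (i + 4)) true); (p, Drain w (inZp (i + 3)) false)]
  | Dummy _ => [:: (p, Star)]
  end.

(** The longest list is that of a [Dead] vertex of a clause: four [Drain] snapshots, [Forced],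
    [Link] and [Select]. No length depends on [m]. *)
Lemma size_occurrences v : size (occurrences v) <= 7.
Proof. by case: v => p [[i|b i k|b i j]|[i|b i k|b i j] j'|i]. Qed.

Lemma mem_consr (T : eqType) (x y : T) l : x \in l -> x \in y :: l.
Proof. by rewrite inE orbC => ->. Qed.

Ltac mem_list := solve [repeat first [exact: mem_head | apply: mem_consr]].

Lemma gedge_occurrences t u v : gedge t u v ->
  (t \in occurrences u) && (t \in occurrences v).
Proof.
case: t u v => q t [p u] [p' v] /= /gedgeP[r /= [-> -> e]].
apply/andP; case: t e => [i|w|i|b i k|w i b|].
- rewrite inE; case E: (onext i) => [j|] /eqP[-> -> ->]; last by split; mem_list.
  by have [_ Ej] := onext_opred E; split; [mem_list | rewrite /occurrences Ej; mem_list].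
- rewrite /=; case: ifP => // cw; rewrite inE => /eqP[-> -> ->].
  by case: w cw => [i|b i j|b i j] _; split; mem_list.
- rewrite !inE => /or3P[/eqP[-> -> ->]|/eqP[-> -> ->]|/nseqP[[-> -> ->] _]];
    by split; mem_list.
- rewrite !mem_cat => /or3P[|/nseqP[[-> -> ->] _]|/nseqP[[-> -> ->] _]].
  + case E: (onext k) => [j|] //; rewrite inE => /eqP[-> -> ->].
    by have [_ Ej] := onext_opred E; split; [mem_list | rewrite /occurrences Ej; mem_list].
  + by split; [mem_list | rewrite /occurrences /rel_cell addnK; mem_list].
  + by split; mem_list.
- rewrite inE => /eqP[-> -> ->]; split; rewrite /occurrences mem_cat; apply/orP; right.
    by case: b; mem_list.
  have : inZp (drain_head i b + (if b then 4 else 3)) = i.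
    by apply: val_inj; case: b; rewrite /= modnDml -addnA modnDr modn_small.
  by move: (drain_head i b) => d; case: b => ->; mem_list.
- by rewrite !inE => /or4P[] /eqP[-> -> ->]; split; mem_list.
Qed.

Lemma gedge_time t t' u v : gedge t u v -> gedge t' u v || gedge t' v u -> t = t'.
Proof.
move=> /gedgeP[r [E1 E2 /edge_timeP[E E']]].
case/orP => /gedgeP[r' [F1 F2 /edge_timeP[F F']]].
  by rewrite [t]surjective_pairing [t']surjective_pairing -E1 -F1; congr pair; move: F; rewrite E => -[].
by rewrite F' in E.
Qed.

Lemma gedge_irrefl t u : gedge t u u = false.
Proof. by apply/negP => /gedgeP[r [_ _ /edge_timeP[->]]]. Qed.

End Gadget.

Section Blocks.
Variables (X : finType) (x0 : X).

(** The elements of a cell are numbered consecutively, so an enumeration of everything is a loop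
    over the cells around a fixed finite list ([map_decode]). The printing of the matrices relies on
    this. *)
Definition decode (i : nat) : nat * X := (i %/ #|X|, nth x0 (enum X) (i %% #|X|)).
Definition recode (y : nat * X) : nat := y.1 * #|X| + index y.2 (enum X).

Lemma card_X_gt0 : 0 < #|X|.
Proof. by apply/card_gt0P; exists x0. Qed.

Lemma index_X (x : X) : index x (enum X) < #|X|.
Proof. by rewrite cardE index_mem mem_enum. Qed.

Lemma recodeK : cancel recode decode.
Proof.
case=> p x; rewrite /decode /recode /= divnMDl ?card_X_gt0 // divn_small ?index_X //.
by rewrite addn0 modnMDl modn_small ?index_X // nth_index // mem_enum.
Qed.

Lemma decodeK : cancel decode recode.
Proof.
move=> i; rewrite /decode /recode /= index_uniq ?enum_uniq -?cardE ?ltn_mod ?card_X_gt0 //.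
by rewrite -divn_eq.
Qed.

Lemma decode_lt a i : ((decode i).1 < a) = (i < a * #|X|).
Proof. by rewrite /decode /= ltn_divLR ?card_X_gt0. Qed.

Lemma recode_lt a y : (recode y < a * #|X|) = (y.1 < a).
Proof. by rewrite -decode_lt recodeK. Qed.

Lemma map_decode (Y : Type) (G : nat * X -> Y) a :
  [seq G (decode i) | i <- iota 0 (a * #|X|)] =
  flatten [seq [seq G (p, x) | x <- enum X] | p <- iota 0 a].
Proof.
elim: a => // a IH; rewrite -addn1 mulnDl mul1n iotaD map_cat IH iotaD map_cat.
rewrite flatten_cat !add0n /= cats0; congr cat.
rewrite -[a * #|X|]addn0 iotaDl -map_comp -[in RHS](mkseq_nth x0 (enum X)) /mkseq -map_comp -cardE.
apply/eq_in_map => i; rewrite mem_iota add0n => /= lt.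
by rewrite /decode divnMDl ?card_X_gt0 // divn_small // addn0 modnMDl modn_small.
Qed.

End Blocks.

Lemma flatten_flatten (T : Type) (sss : seq (seq (seq T))) :
  flatten (flatten sss) = flatten (map flatten sss).
Proof. by elim: sss => //= ss sss IH; rewrite flatten_cat IH. Qed.

Lemma set2_inj (T : finType) (a b c d : T) :
  [set a; b] = [set c; d] -> (a, b) = (c, d) \/ (a, b) = (d, c).
Proof.
move=> /setP E; have := E a; have := E b; have := E c; have := E d.
rewrite !inE !eqxx ?orbT /= => hd hc /esym hb /esym ha.
case/orP: ha => /eqP E1; case/orP: hb => /eqP E2; rewrite E1 E2 ?orbb in hc hd *; auto.
  by left; rewrite (eqP hd).
by left; rewrite (eqP hc).
Qed.

(** * The instance: its parameters, its correctness and its code *)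

Section Instance.
Variables (m : nat) (conflict : bool -> rel 'I_m) (width cells : nat).
Variable forbidden : nat -> pred 'I_m.
Hypothesis width_gt0 : 0 < width.

Local Notation V := (vertex m).
Local Notation Tm := (time m).
Local Notation n := (cells * #|{: V}|).
Local Notation len := (cells * #|{: Tm}|).
Local Notation vdec := (@decode V (Dummy ord0)).
Local Notation vrec := (@recode V).
Local Notation tdec := (@decode Tm Star).
Local Notation trec := (@recode Tm).
Local Notation gedge := (@gedge m conflict width forbidden).

Definition adjacent (t : gtime m) (u v : gvertex m) : bool := gedge t u v || gedge t v u.

Definition gadget_snapshot (i : 'I_len) : {set {set 'I_n}} :=
  [set e | [exists u : 'I_n, exists v : 'I_n,
     adjacent (tdec i) (vdec u) (vdec v) && (e == [set u; v])]].

Lemma gadget_snapshotP (i : 'I_len) e : reflect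
  (exists u v : 'I_n, gedge (tdec i) (vdec u) (vdec v) /\ e = [set u; v])
  (e \in gadget_snapshot i).
Proof.
rewrite inE; apply: (iffP existsP) => [[u /existsP[v /andP[/orP[] H /eqP E]]]|[u [v [H E]]]].
- by exists u, v.
- by exists v, u; rewrite setUC.
- by exists u; apply/existsP; exists v; rewrite /adjacent H E eqxx.
Qed.

Lemma vdec_neq t (u v : 'I_n) : gedge t (vdec u) (vdec v) -> u != v.
Proof. by apply: contraTneq => ->; rewrite gedge_irrefl. Qed.

Lemma in_gadget_snapshot (i : 'I_len) (u v : 'I_n) :
  ([set u; v] \in gadget_snapshot i) = adjacent (tdec i) (vdec u) (vdec v).
Proof.
apply/gadget_snapshotP/idP => [[u' [v' [H /set2_inj[[-> ->]|[-> ->]]]]]|/orP[] H].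
- by rewrite /adjacent H.
- by rewrite /adjacent H orbT.
- by exists u, v.
- by exists v, u; rewrite setUC.
Qed.

Lemma gadget_simple i e : e \in gadget_snapshot i -> #|e| = 2.
Proof. by case/gadget_snapshotP => u [v [/vdec_neq ne ->]]; rewrite cards2 ne. Qed.

Definition gadget_graph : temporal_graph 'I_n len := TemporalGraph gadget_simple.

Definition gadget_instance : tvc_instance := @TVCInstance _ _ gadget_graph 2 0 isT.

Lemma gadget_time i i' e :
  e \in gadget_snapshot i -> e \in gadget_snapshot i' -> i = i'.
Proof.
move=> /gadget_snapshotP[u [v [H ->]]]; rewrite in_gadget_snapshot => H'.
by apply: val_inj; rewrite -[LHS](decodeK (Star : Tm)) (gedge_time H H') decodeK.
Qed.

Lemma in_underlying e :
  e \in underlying_edges gadget_graph -> exists i, e \in gadget_snapshot i.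
Proof. by case/bigcupP => i _ H; exists i. Qed.

Lemma gadget_each_edge_once : each_edge_once gadget_graph.
Proof.
move=> e /in_underlying[i H]; apply/eqP/cards1P; exists i.
apply/setP => i'; rewrite in_set in_set1; apply/idP/eqP => [H'|->//].
exact: (@gadget_time i' i e H' H).
Qed.

(** Both occurrences [p] and [q] of an edge coincide, and [i] lies between them. *)
Lemma gadget_interval_membership i :
  interval_membership gadget_graph i = gadget_snapshot i.
Proof.
apply/setP => e; rewrite inE; apply/idP/idP => [/andP[_]|H].
  case/existsP => p /existsP[q /andP[/andP[l1 l2] /setIP[H1 H2]]].
  rewrite (_ : i = p) //; apply: val_inj; apply/eqP; rewrite eqn_leq l1.
  by rewrite (gadget_time H1 H2) l2.
apply/andP; split; first by apply/bigcupP; exists i.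
by apply/existsP; exists i; apply/existsP; exists i; rewrite leqnn inE H.
Qed.

Lemma card_gadget_snapshot i : #|gadget_snapshot i| <= 4.
Proof.
pose l := local_edges conflict (forbidden (tdec i).1) (tdec i).2.
(* A set of all suitable [w] rather than a pair, since the far end of a listed edge may lie outside
   the grid. *)
pose g (e : V * (option bool * V)) : {set 'I_n} := [set w : 'I_n |
  (vdec w == ((tdec i).1, e.1)) || (vdec w == (rel_cell width e.2.1 (tdec i).1, e.2.2))].
apply: leq_trans (size_local_edges conflict (forbidden (tdec i).1) (tdec i).2).
rewrite -/l -(size_map g l) cardE; apply: uniq_leq_size (enum_uniq _) _ => e.
rewrite mem_enum => /gadget_snapshotP[u [v [/gedgeP[r [E1 E2 H]] ->]]].
apply/mapP; exists ((vdec u).2, (r, (vdec v).2)) => //.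
apply/setP => w; rewrite [RHS]in_set !inE; cbn [fst snd].
rewrite -E2 -E1 -!surjective_pairing.
by rewrite !(can_eq (decodeK (Dummy ord0 : V))) !val_eqE.
Qed.

Lemma gadget_imw : 0 < cells -> imw gadget_graph = 4.
Proof.
move=> c0; apply/eqP; rewrite eqn_leq; apply/andP; split.
  by apply/bigmax_leqP => i _; rewrite gadget_interval_membership card_gadget_snapshot.
have lt_i : trec (0, Star) < len by rewrite (recode_lt (Star : Tm)).
have lt_u j : vrec (0, Dummy j) < n by rewrite (recode_lt (Dummy ord0 : V)).
pose i := Ordinal lt_i; pose u j := Ordinal (lt_u j).
apply: leq_trans (leq_bigmax i); rewrite gadget_interval_membership.
pose e (j : 'I_4) := [set u (inZp 0); u (inZp j.+1)].
have u_inj : injective u.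
  by move=> j j' /(congr1 val) /= /(can_inj (recodeK (Dummy ord0 : V))) [].
have e_inj : injective e.
  have mod5 (k : 'I_4) : k.+1 %% 5 = k.+1 by apply: modn_small; exact: (ltn_ord k).
  move=> j j' /set2_inj[] E.
    have /u_inj/(congr1 val) := congr1 snd E.
    by rewrite /= !mod5 => -[] /val_inj.
  have /u_inj/(congr1 val) := congr1 fst E.
  by rewrite /= mod5.
rewrite -(card_ord 4) -cardsT -(card_imset _ e_inj); apply: subset_leq_card.
apply/subsetP => _ /imsetP[j _ ->]; rewrite in_gadget_snapshot /adjacent /= !recodeK.
rewrite (@gedgeI m conflict width forbidden 0 Star _ None) //=.
by case: j => [[|[|[|[|]]]] //=].
Qed.

Lemma gadget_degree v : underlying_degree gadget_graph v <= 28.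
Proof.
pose f t : seq {set 'I_n} := if insub (trec t) is Some i then enum (gadget_snapshot i) else [::].
rewrite /underlying_degree cardE.
have sub : {subset enum [set e in underlying_edges gadget_graph | v \in e]
             <= flatten [seq f t | t <- occurrences width (vdec v)]}.
  move=> e; rewrite mem_enum inE => /andP[/in_underlying[i H] ve].
  apply/flattenP; exists (enum (gadget_snapshot i)); last by rewrite mem_enum.
  apply/mapP; exists (tdec i); last by rewrite /f decodeK valK.
  case/gadget_snapshotP: H ve => u [w [g ->]]; have /andP[Hu Hw] := gedge_occurrences g.
  by rewrite !inE => /orP[] /eqP ->.
apply: leq_trans (uniq_leq_size (enum_uniq _) sub) _.
have := size_occurrences width (vdec v).
have szf t : size (f t) <= 4.
  rewrite /f; case: insub => // i; rewrite -cardE; exact: card_gadget_snapshot.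
have sz l : size (flatten [seq f t | t <- l]) <= size l * 4.
  by elim: l => //= t l IH; rewrite size_cat mulSn leq_add.
by move=> H; apply: leq_trans (sz _) _; exact: (leq_mul H (leqnn 4)).
Qed.

Lemma gadget_yes : 0 < m -> tvc_yes gadget_instance <->
  exists tau, is_tiling conflict width cells forbidden tau.
Proof.
move=> m0; split=> [[S [[Sle Sl Sk] Scov]]|[tau H]].
  (* As [l = 0], every interval is a point, and activity amounts to membership of [(v, i, i)].
     Positions outside the grid count as inactive. *)
  pose act (u : gvertex m) (t : gtime m) : bool :=
    match insub (vrec u) : option 'I_n, insub (trec t) : option 'I_len with
    | Some v, Some i => (v, i, i) \in S
    | _, _ => false
    end.
  have actE (v : 'I_n) (i : 'I_len) : act (vdec v) (tdec i) = ((v, i, i) \in S).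
    by rewrite /act !decodeK !valK.
  apply: (@tiling_of_cover m conflict width cells forbidden width_gt0 act) => //.
    move=> u ts; rewrite -(recode_lt (Dummy ord0 : V)) => lt uts.
    pose v := Ordinal lt; apply: leq_trans (Sk v).
    (* The active snapshots among [ts] are injected into the intervals of [v]. *)
    pose l := [seq t <- ts | act u t].
    pose is_ : seq 'I_len := pmap insub (map trec l).
    have sz : size is_ = count (act u) ts.
      rewrite size_pmap_sub count_map -[RHS]size_filter -/l -[RHS]count_predT.
      apply: eq_in_count => t; rewrite mem_filter => /andP[+ _].
      by rewrite /act /=; case: (insub (vrec u)) => // v'; case: insubP.
    have uis : uniq is_.
      by rewrite pmap_sub_uniq // map_inj_uniq ?filter_uniq //; exact: can_inj (recodeK (Star : Tm)).
    rewrite -sz cardE -(size_map (fun i => (v, i, i))); apply: uniq_leq_size.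
      by rewrite map_inj_uniq // => i j [].
    move=> x /mapP[i]; rewrite mem_pmap_sub /= => /mapP[t].
    rewrite mem_filter => /andP[a _] Ei ->; rewrite mem_enum inE eqxx andbT.
    by rewrite -actE /= recodeK Ei recodeK.
  move=> t u v; rewrite -(recode_lt (Star : Tm)) -(recode_lt (Dummy ord0 : V)) => lt ltv e.
  have ltu : vrec u < n.
    rewrite (recode_lt (Dummy ord0 : V)); case/gedgeP: e => r [-> _ _].
    by rewrite -(recode_lt (Star : Tm)).
  have := Scov (Ordinal lt) [set Ordinal ltu; Ordinal ltv].
  rewrite [_ \in _]in_gadget_snapshot /adjacent /= !recodeK e => /(_ isT)[w wuv [a [b [ab /andP[la lb]]]]].
  have Eab : a = b.
    apply: val_inj; apply/eqP; rewrite eqn_leq (Sle _ _ _ ab) -subn_eq0 -leqn0.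
    exact: Sl ab.
  have Ea : a = Ordinal lt.
    by apply: val_inj; apply/eqP; rewrite eqn_leq la /= {1}Eab lb.
  rewrite -Eab Ea -actE /= recodeK in ab.
  by move: wuv ab; rewrite !inE => /orP[] /eqP -> /=; rewrite recodeK => ->; rewrite ?orbT.
exists [set x : 'I_n * 'I_len * 'I_len | (x.1.2 == x.2)
   && (tdec x.2 \in schedule width tau (vdec x.1.1))].
split; last first.
  move=> i e /gadget_snapshotP[u [v [g ->]]].
  have lt_i : (tdec i).1 < cells by rewrite decode_lt.
  have lt_v : (vdec v).1 < cells by rewrite decode_lt.
  have := schedule_covers width_gt0 H lt_i lt_v g.
  by case/orP => a; [exists u|exists v]; rewrite ?inE ?eqxx ?orbT //;
    exists i, i; rewrite inE /= eqxx a leqnn.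
split=> [v a b|v a b|v].
- by rewrite inE /= => /andP[/eqP -> _].
- by rewrite inE /= => /andP[/eqP -> _]; rewrite subnn.
apply: leq_trans (size_schedule width tau (vdec v)).
set A := [set I in _ | _]; rewrite cardE -(size_map (fun x : 'I_n * 'I_len * 'I_len => tdec x.2)).
apply: uniq_leq_size.
  rewrite map_inj_in_uniq ?enum_uniq // => -[[v1 a1] b1] [[v2 a2] b2].
  rewrite !mem_enum !inE /= => /andP[/andP[/eqP -> _] /eqP ->] /andP[/andP[/eqP -> _] /eqP ->].
  by move/(can_inj (decodeK (Star : Tm)))/val_inj ->.
move=> x /mapP[[[v' a] b]]; rewrite mem_enum !inE /= => /andP[/andP[_ H'] /eqP <-] ->.
exact: H'.
Qed.

Definition gadget_bits : seq bool :=
  flatten [seq flatten [seq flatten [seq flatten [seq flatten [seq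
    [seq adjacent (q, h) (p, g) (p', g') | g' <- enum {: V}]
      | p' <- iota 0 cells] | g <- enum {: V}] | p <- iota 0 cells]
      | h <- enum {: Tm}] | q <- iota 0 cells].

Lemma gadget_encode : tvc_encode gadget_instance =
  unary n ++ unary len ++ delimit (binary 2) ++ delimit (binary 0) ++ gadget_bits.
Proof.
rewrite /tvc_encode; do 4!congr cat; rewrite /gadget_bits.
pose row t u := [seq adjacent t u (vdec v) | v <- iota 0 n].
pose mat t := flatten [seq row t (vdec u) | u <- iota 0 n].
transitivity (flatten [seq mat (tdec i) | i <- iota 0 len]).
  congr flatten; rewrite -val_enum_ord -map_comp; apply: eq_map => i /=.
  rewrite /mat; congr flatten; rewrite -val_enum_ord -map_comp; apply: eq_map => u /=.
  rewrite /row -val_enum_ord -map_comp; apply: eq_map => v /=.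
  exact: in_gadget_snapshot.
rewrite (map_decode _ mat) flatten_flatten -map_comp; congr flatten; apply: eq_map => q /=.
congr flatten; apply: eq_map => h; rewrite /mat.
rewrite (map_decode _ (row _)) flatten_flatten -map_comp; congr flatten; apply: eq_map => p /=.
by congr flatten; apply: eq_map => g; rewrite /row map_decode.
Qed.

End Instance.

(** * Computations as tilings *)

(** In the [FreeBit] cells the tiling guesses the certificate; a blank is allowed there, since
    certificates may be shorter than the bound. *)
Inductive label := LeftBlank | InputBit of bool | FreeBit | RightBlank | LaterRow.

Definition label_code (l : label) : bool + bool * bool :=
  match l with
  | InputBit b => inl b
  | LeftBlank => inr (false, false)
  | FreeBit => inr (false, true)
  | RightBlank => inr (true, false)
  | LaterRow => inr (true, true)
  end.

Definition label_decode (x : bool + bool * bool) : label :=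
  match x with
  | inl b => InputBit b
  | inr (false, false) => LeftBlank
  | inr (false, true) => FreeBit
  | inr (true, false) => RightBlank
  | inr (true, true) => LaterRow
  end.

Lemma label_codeK : cancel label_code label_decode.
Proof. by case. Qed.

HB.instance Definition _ := Finite.copy label (can_type label_codeK).

Section Tableau.
Variable M : TM.
Local Notation tape := 'I_(tm_tapes M).+1.
Local Notation blank := (tm_blank M).

(* Position of a cell relative to a head: [None] under it, [Some b] strictly to
   its right if [b], strictly to its left otherwise. *)
Definition side := option bool.

Definition compare (z h : int) : side := if z == h then None else Some (h < z)%R.

(** The conflict relations see tiles but no labels; hence a tile itself records whether it lies in
    the first row ([initial]) and where it lies relative to tape cell 0 ([origin]), which marks the
    output cell and the ends of rows. *)
Definition tile := (side * bool * tm_state M * {ffun tape -> tm_sym M}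
                    * {ffun tape -> tm_sym M * side})%type.

Definition origin (s : tile) : side := s.1.1.1.1.
Definition initial (s : tile) : bool := s.1.1.1.2.
Definition tstate (s : tile) : tm_state M := s.1.1.2.
Definition treads (s : tile) : {ffun tape -> tm_sym M} := s.1.2.
Definition tsym (s : tile) (k : tape) : tm_sym M := (s.2 k).1.
Definition head_side (s : tile) (k : tape) : side := (s.2 k).2.

(** Read from left to right, a head is never passed unnoticed and never met twice: [Some false]
    turns into [Some true] only through a single [None]. *)
Definition follows (a b : side) : bool :=
  match a, b with
  | Some false, Some true => false
  | Some false, _ => true
  | None, Some true | Some true, Some true => true
  | _, _ => false
  end.

(** One column cannot tell whether a head approaching it has arrived; this ambiguity is left open
    here and settled by [follows] with the neighbouring column. *)
Definition moves_to (d : move) (a b : side) : bool :=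
  match d with
  | MoveS => b == a
  | MoveR => if a is Some true then b != Some false else b == Some false
  | MoveL => if a is Some false then b != Some true else b == Some true
  end.

Definition transition (q : tm_state M) (r : {ffun tape -> tm_sym M}) :=
  if tm_halt q then (q, [ffun k => (r k, MoveS)]) else tm_delta q r.

(* The last cell of a row is followed by the first cell of the next row; these two
   are on opposite sides of the origin, and there is no constraint between them. *)
Definition row_ok (s s' : tile) : bool :=
  (origin s == Some true) && (origin s' == Some false) ||
  [&& follows (origin s) (origin s'), tstate s == tstate s', treads s == treads s',
      [forall k, follows (head_side s k) (head_side s' k)]
    & [&& initial s, initial s' & origin s != Some false] ==>
      (tsym s ord0 == blank) ==> (tsym s' ord0 == blank)].

Definition column_ok (s s' : tile) : bool :=
  let: (q, act) := transition (tstate s) (treads s) in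
  [&& origin s' == origin s, tstate s' == q
    & [forall k, (tsym s' k == if head_side s k == None then (act k).1 else tsym s k)
                 && moves_to (act k).2 (head_side s k) (head_side s' k)]].

(** Acceptance is required in every row with a halting state, not just in the last: halted
    configurations repeat, so the last row needs no label of its own. *)
Definition tile_ok (l : label) (s : tile) : bool :=
  [&& [forall k, (head_side s k == None) ==> (tsym s k == treads s k)],
      tm_halt (tstate s) && (origin s == None) ==> (tsym s ord_max == tm_bit M true)
    & if l == LaterRow then ~~ initial s else
      [&& initial s, tstate s == tm_start M, (origin s == Some false) == (l == LeftBlank),
          [forall k, head_side s k == origin s],
          [forall k, (k != ord0) ==> (tsym s k == blank)]
        & match l with
          | InputBit b => tsym s ord0 == tm_bit M b
          | FreeBit => tsym s ord0 \in [:: tm_bit M true; tm_bit M false; blank]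
          | _ => tsym s ord0 == blank
          end]].

Lemma follows_compare z h : follows (compare z h) (compare (z + 1)%R h).
Proof.
rewrite /compare; case: (z =P h) => [->|ne]; last case: (_ =P h) => [E|ne'].
- have -> : (h + 1 == h :> int)%R = false by lia.
  by have -> : (h < h + 1)%R by lia.
- by have -> : (h < z)%R = false by lia.
- have [lt|lt] : (h < z)%R \/ (z < h)%R by lia.
    by rewrite lt; have -> : (h < z + 1)%R by lia.
  have -> : (h < z)%R = false by lia.
  by have -> : (h < z + 1)%R = false by lia.
Qed.

Lemma moves_to_compare d z h : moves_to d (compare z h) (compare z (h + shift d)%R).
Proof.
rewrite /compare; case: d => /=; last 2 first.
- by rewrite GRing.addr0.
- case: (z =P h) => [->|ne].
    have -> : (h == h + 1 :> int)%R = false by lia.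
    by have -> : (h + 1 < h)%R = false by lia.
  have [lt|lt] : (h < z)%R \/ (z < h)%R by lia.
    rewrite lt; case: (z =P _) => // ne'.
    by have -> : (h + 1 < z)%R by lia.
  have -> : (h < z)%R = false by lia.
  have -> : (z == h + 1 :> int)%R = false by lia.
  by have -> : (h + 1 < z)%R = false by lia.
- case: (z =P h) => [->|ne].
    have -> : (h == h - 1 :> int)%R = false by lia.
    by have -> : (h - 1 < h)%R by lia.
  have [lt|lt] : (h < z)%R \/ (z < h)%R by lia.
    rewrite lt; have -> : (z == h - 1 :> int)%R = false by lia.
    by have -> : (h - 1 < z)%R by lia.
  have -> : (h < z)%R = false by lia.
  case: (z =P _) => // ne'.
  by have -> : (h - 1 < z)%R = false by lia.
Qed.

Lemma follows_uniq (N h : nat) (b : nat -> side) :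
  (forall j, j.+1 < N -> follows (b j) (b j.+1)) -> h < N -> b h = None ->
  forall j, j < N -> b j = if j == h then None else Some (h < j).
Proof.
move=> fol lt bh.
have up d : h + d.+1 < N -> b (h + d.+1) = Some true.
  elim: d => [|d IH] l.
    by have := fol h; rewrite addn1 in l *; rewrite bh => /(_ l); case: (b _) => [[]|].
  have {}IH := IH ltac:(lia); have := fol (h + d.+1); rewrite -addnS IH => /(_ l).
  by case: (b _) => [[]|].
have down d : d < h -> b (h - d.+1) = Some false.
  elim: d => [|d IH] l.
    have := fol h.-1; rewrite prednK ?(leq_ltn_trans _ l) // bh subn1 => /(_ lt).
    by case: (b _) => [[]|].
  have {}IH := IH ltac:(lia); have := fol (h - d.+2).
  rewrite (_ : (h - d.+2).+1 = h - d.+1) ?IH; last by lia.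
  by move=> /(_ ltac:(lia)); case: (b _) => [[]|].
move=> j ltj; case: (ltngtP j h) => [l|l|->] //.
  have E : h - (h - j).-1.+1 = j by lia.
  by rewrite -E down //; lia.
have E : h + (j - h).-1.+1 = j by lia.
by rewrite -E up //; lia.
Qed.

End Tableau.

Lemma size_delimit w : size (delimit w) = 2 * size w + 1.
Proof. by rewrite /delimit size_cat /=; elim: w => //= b w; lia. Qed.

(** In [S] steps the heads stay within distance [S] of tape cell 0, which is column [S.+2]; the
    margins keep a head and both neighbouring columns inside the row. *)
Definition first_row (S B : nat) (w : seq bool) : seq label :=
  nseq S.+2 LeftBlank ++ map InputBit w ++ nseq B FreeBit ++ nseq S.+1 RightBlank.

Arguments first_row : simpl never.

Definition labels (S B : nat) (w : seq bool) : seq label :=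
  first_row S B w ++ nseq (S * size (first_row S B w)) LaterRow.

Lemma size_first_row S B w : size (first_row S B w) = S.+2 + (size w + (B + S.+1)).
Proof. by rewrite /first_row !size_cat !size_nseq size_map. Qed.

Lemma nth_first_row S B w j :
  nth LaterRow (first_row S B w) j =
  if j < S.+2 then LeftBlank
  else if j < S.+2 + size w then InputBit (nth false w (j - S.+2))
  else if j < S.+2 + size w + B then FreeBit
  else if j < S.+2 + (size w + (B + S.+1)) then RightBlank else LaterRow.
Proof.
rewrite /first_row !nth_cat !size_nseq size_map !nth_nseq.
move: S.+1 S.+2 => S' O.
have [l1|l1] := ltnP j O; first by [].
have -> : (j - O < size w) = (j < O + size w) by lia.
have [l2|l2] := ltnP j (O + size w); first by rewrite (nth_map false) //; lia.
have -> : (j - O - size w < B) = (j < O + size w + B) by lia.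
have [l3|l3] := ltnP j (O + size w + B); first by [].
by have -> : (j - O - size w - B < S') = (j < O + (size w + (B + S'))) by lia.
Qed.

(** Blanks propagate to the right, so the guessed cells spell a word padded with blanks: the
    certificate. *)
Lemma free_word (T : eqType) (blank : T) (bit : bool -> T) B (a : nat -> T) :
  (forall i, i < B -> a i \in [:: bit true; bit false; blank]) ->
  (forall i, i.+1 < B -> a i = blank -> a i.+1 = blank) ->
  exists2 y, size y <= B & forall i, i < B -> a i = nth blank (map bit y) i.
Proof.
elim: B a => [|B IH] a ok mono; first by exists [::].
have [a0|a0] := eqVneq (a 0) blank.
  exists [::] => // i; rewrite nth_nil; elim: i => // i IHi lt.
  by apply: mono => //; apply: IHi; exact: ltnW.
have [y sz E] := IH (fun i => a i.+1) (fun i => ok i.+1) (fun i => mono i.+1).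
have [b Eb] : exists b, a 0 = bit b.
  by have := ok 0 isT; rewrite !inE (negPf a0) orbF => /orP[] /eqP; [exists true|exists false].
by exists (b :: y) => // -[|i] lt //=; exact: E.
Qed.

(** * Accepting computations correspond to tableaux *)

Section Simulation.
Variables (M : TM) (V : seq bool -> bool) (t : nat -> nat).
Hypothesis comp : computes_in_time M (fun w => [:: V w]) t.
Variables (S B : nat) (x : seq bool).
Hypothesis bound : forall y, size y <= B -> t (size (pair_code x y)) <= S.

Local Notation tape := 'I_(tm_tapes M).+1.
Local Notation blank := (tm_blank M).
Local Notation labs := (labels S B (delimit x)).
Local Notation N := (size (first_row S B (delimit x))).
Local Notation O := S.+2.

Definition column (j : nat) : int := (Posz j - Posz O)%R.

Definition run (y : seq bool) (r : nat) : config M :=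
  iter r (@step M) (init_config M (pair_code x y)).

Definition scan (c : config M) : {ffun tape -> tm_sym M} :=
  [ffun k => c_tape c k (c_head c k)].

Lemma N_gt : O + S.+1 < N.
Proof. by rewrite size_first_row size_delimit; lia. Qed.

Lemma step_transition (c : config M) :
  let: (q, act) := transition (c_state c) (scan c) in
  [/\ c_state (step c) = q,
      forall k z, c_tape (step c) k z =
        if z == c_head c k then (act k).1 else c_tape c k z
    & forall k, c_head (step c) k = (c_head c k + shift (act k).2)%R].
Proof.
rewrite /transition /step; case: ifP => h; last first.
  by rewrite -/(scan c); case: tm_delta.
split=> [|k z|k] //; rewrite !ffunE //= ?GRing.addr0 //.
by case: eqP => // ->.
Qed.

Lemma run_head y r k : (- Posz r <= c_head (run y r) k <= Posz r)%R.
Proof.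
elim: r => //= r IH; have := step_transition (run y r).
case: transition => q act [_ _ ->]; case: (act k).2 => /=; lia.
Qed.

Lemma run_halted y r r' : r <= r' -> tm_halt (c_state (run y r)) -> run y r' = run y r.
Proof.
move=> le h; rewrite -(subnK le) /run iterD -/(run y r).
by elim: (r' - r) => //= i ->; rewrite /step h.
Qed.

Lemma run_output y r : size y <= B -> tm_halt (c_state (run y r)) ->
  c_tape (run y r) ord_max 0%R = tm_bit M (V (pair_code x y)).
Proof.
move=> sz h; have := comp (pair_code x y); cbv zeta.
rewrite -/(run y _); set T := t _ => -[hT out].
suff -> : run y r = run y T by rewrite out.
by case: (leqP r T) => [le|/ltnW le]; rewrite (run_halted le).
Qed.

Definition is_tableau (tau : nat -> tile M) : Prop :=
  forall p, p < S.+1 * N ->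
    [/\ tile_ok (nth LaterRow labs p) (tau p),
        p + 1 < S.+1 * N -> row_ok (tau p) (tau (p + 1))
      & p + N < S.+1 * N -> column_ok (tau p) (tau (p + N))].

Lemma nth_labels r j : j < N ->
  nth LaterRow labs (r * N + j) =
  if r == 0 then nth LaterRow (first_row S B (delimit x)) j else LaterRow.
Proof.
move=> lt; rewrite /labels nth_cat; case: r => [|r] /=; first by rewrite mul0n add0n lt.
by rewrite mulSn -addnA ltnNge leq_addr /= nth_nseq if_same.
Qed.

Section Tiling_of_run.
Variable y : seq bool.
Hypotheses (szy : size y <= B) (acc : V (pair_code x y)).

Definition run_tile (r j : nat) : tile M :=
  let c := run y r in
  (compare (column j) 0, r == 0, c_state c, scan c,
   [ffun k => (c_tape c k (column j), compare (column j) (c_head c k))]).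

Lemma word_tapeE (w : seq bool) i :
  word_tape M w (Posz i) = nth blank (map (@tm_bit M) w) i.
Proof. by []. Qed.

Lemma run_tile_ok r j : r <= S -> j < N ->
  tile_ok (nth LaterRow labs (r * N + j)) (run_tile r j).
Proof.
move=> le lt; rewrite nth_labels //; apply/and3P; split.
- apply/forallP => k; apply/implyP; rewrite /head_side /tsym /treads /= !ffunE /= /compare.
  by case: (column j =P c_head (run y r) k) => [->|].
- apply/implyP => /andP[h]; rewrite /origin /tsym /= ffunE /= /compare.
  by case: (column j =P 0%R) => [-> _|//]; rewrite run_output // acc.
case: r le => [|r] le; last by rewrite /=.
rewrite [0 == 0]/= nth_first_row -!size_first_row lt.
have szd : size (delimit x) = 2 * size x + 1 by exact: size_delimit.
have E0 : tsym (run_tile 0 j) ord0 = word_tape M (pair_code x y) (column j).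
  by rewrite /tsym /= ffunE.
have Eneg : j < O -> origin (run_tile 0 j) = Some false.
  move=> l; rewrite /origin /= /compare /column.
  have -> : (Posz j - Posz O == 0 :> int)%R = false by lia.
  by have -> : (0 < Posz j - Posz O)%R = false by lia.
have Epos : O <= j -> (origin (run_tile 0 j) == Some false) = false.
  move=> l; rewrite /origin /= /compare /column; case: (_ - _ =P 0 :> int)%R => // ne.
  by have -> : (0 < Posz j - Posz O)%R by lia.
have Ecol : O <= j -> column j = Posz (j - O) by rewrite /column; lia.
have common (l : label) : (j < O) = (l == LeftBlank) ->
  [&& initial (run_tile 0 j), tstate (run_tile 0 j) == tm_start M,
      (origin (run_tile 0 j) == Some false) == (l == LeftBlank),
      [forall k, head_side (run_tile 0 j) k == origin (run_tile 0 j)]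
    & [forall k, (k != ord0) ==> (tsym (run_tile 0 j) k == blank)]].
  move=> <-; apply/and5P; split => //.
  - by case: (ltnP j O) => [/Eneg ->|/Epos ->].
  - by apply/forallP => k; rewrite /head_side /= ffunE.
  - apply/forallP => k; apply/implyP => /negPf ne; rewrite /tsym /= ffunE /= ne.
    by rewrite /word_tape; case: column => // i; rewrite nth_nil.
have mk l (Q : bool) : (j < O) = (l == LeftBlank) -> Q ->
  [&& initial (run_tile 0 j), tstate (run_tile 0 j) == tm_start M,
      (origin (run_tile 0 j) == Some false) == (l == LeftBlank),
      [forall k, head_side (run_tile 0 j) k == origin (run_tile 0 j)],
      [forall k, (k != ord0) ==> (tsym (run_tile 0 j) k == blank)]
    & Q].
  by move=> /common/and5P[-> -> -> -> ->] ->.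
case: (ltnP j O) => l1.
  apply: mk; first by rewrite l1.
  rewrite E0 /column.
  by case E: (_ - _)%R => [i|i] //; lia.
case: (ltnP j (O + size (delimit x))) => l2.
  apply: mk; first by rewrite ltnNge l1.
  have ls : j - O < size (pair_code x y) by rewrite size_cat; lia.
  by rewrite E0 (Ecol l1) word_tapeE (nth_map false) // nth_cat ltn_subLR // l2.
have l2' : size (delimit x) <= j - O by lia.
case: (ltnP j (O + size (delimit x) + B)) => l3.
  apply: mk; first by rewrite ltnNge l1.
  rewrite E0 (Ecol l1) word_tapeE.
  set w := pair_code x y; case: (ltnP (j - O) (size w)) => ls.
    by rewrite (nth_map false) // !inE; case: nth; rewrite eqxx ?orbT.
  by rewrite nth_default ?size_map // !inE eqxx !orbT.
apply: mk; first by rewrite ltnNge l1.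
rewrite E0 (Ecol l1) word_tapeE nth_default // size_map size_cat; lia.
Qed.

Lemma run_row_ok r j : j.+1 < N -> row_ok (run_tile r j) (run_tile r j.+1).
Proof.
move=> lt; have Ec : column j.+1 = (column j + 1)%R by rewrite /column; lia.
apply/orP; right; apply/and5P; split => //.
- by rewrite /origin /= Ec follows_compare.
- by apply/forallP => k; rewrite /head_side /= !ffunE /= Ec follows_compare.
apply/implyP => /and3P[/eqP r0 _]; rewrite /origin /tsym /= !ffunE r0 /= /compare => H.
apply/implyP; have [i Ei] : exists i, column j = Posz i.
  by case E: (column j) H => [i|i] //; exists i.
rewrite Ec Ei (_ : (Posz i + 1)%R = Posz i.+1); last by lia.
rewrite !word_tapeE => /eqP bi.
(* Bits are never blank, so a blank at a nonnegative cell lies beyond the end of the word. *)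
rewrite nth_default // size_map; apply: leqW; rewrite leqNgt; apply/negP => l.
by move/eqP: bi; rewrite (nth_map false) // (negPf (@tm_bit_blank M _)).
Qed.

Lemma run_wrap_ok r r' j : j = N.-1 -> row_ok (run_tile r j) (run_tile r' 0).
Proof.
move=> ->; have := N_gt; case: N => // n NO; rewrite /row_ok /origin /= /compare /column.
have -> : (Posz n - Posz O == 0 :> int)%R = false by lia.
by have -> : (0 < Posz n - Posz O)%R by lia.
Qed.

Lemma run_column_ok r j : column_ok (run_tile r j) (run_tile r.+1 j).
Proof.
rewrite /column_ok.
have -> : tstate (run_tile r j) = c_state (run y r) by [].
have -> : treads (run_tile r j) = scan (run y r) by [].
have := step_transition (run y r); case: transition => q act [Eq Et Eh].
apply/and3P; split => //; first by rewrite -Eq.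
apply/forallP => k; rewrite /tsym /head_side /= !ffunE /= Et Eh moves_to_compare andbT.
by rewrite /compare; case: (column j =P c_head (run y r) k).
Qed.

Lemma tableau_of_run : exists tau, is_tableau tau.
Proof.
have N0 : 0 < N by apply: leq_ltn_trans N_gt.
exists (fun p => run_tile (p %/ N) (p %% N)) => p lt.
have rS : p %/ N <= S by rewrite -ltnS ltn_divLR.
have jN : p %% N < N by rewrite ltn_mod.
split=> [|_|_].
- by rewrite {1}(divn_eq p N) run_tile_ok.
- have [l|l] : (p %% N).+1 < N \/ p %% N = N.-1 by lia.
    rewrite {3 4}(divn_eq p N) -addnA addn1 divnMDl // modnMDl.
    by rewrite (divn_small l) (modn_small l) addn0 run_row_ok.
  rewrite {3 4}(divn_eq p N) -addnA addn1 divnMDl // modnMDl l prednK // modnn.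
  exact: run_wrap_ok.
- by rewrite divnDr // divnn N0 modnDr addn1 run_column_ok.
Qed.

End Tiling_of_run.

(** * Every tableau describes an accepting computation *)

Section Run_of_tiling.
Variable tau : nat -> tile M.
Hypothesis tauP : is_tableau tau.

Local Notation g r j := (tau (r * N + j)).

Lemma cell_lt r j : r <= S -> j < N -> r * N + j < S.+1 * N.
Proof.
move=> le lt; apply: (@leq_trans (r.+1 * N)); first by rewrite mulSn addnC ltn_add2r.
by rewrite leq_mul2r ltnS le orbT.
Qed.

Lemma tableau_tile r j : r <= S -> j < N ->
  tile_ok (nth LaterRow labs (r * N + j)) (g r j).
Proof. by move=> le lt; have [] := tauP (cell_lt le lt). Qed.

Lemma tableau_column r j : r < S -> j < N -> column_ok (g r j) (g r.+1 j).
Proof.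
move=> le lt; have [_ _] := tauP (cell_lt (ltnW le) lt).
have -> : r * N + j + N = r.+1 * N + j by rewrite mulSn; lia.
by apply; exact: cell_lt.
Qed.

Lemma tableau_row r j : r <= S -> j.+1 < N -> row_ok (g r j) (g r j.+1).
Proof.
move=> le lt; have [_ + _] := tauP (cell_lt le (ltnW lt)).
by rewrite -addnA addn1; apply; exact: cell_lt.
Qed.

Lemma compare_column j h : compare (column j) (column h) =
  if j == h then None else Some (h < j).
Proof.
rewrite /compare /column; case: eqP => [E|E]; first by rewrite ifT //; lia.
by rewrite ifN; [congr Some; lia | lia].
Qed.

Lemma columnO : column O = 0%R.
Proof. by rewrite /column; lia. Qed.

Lemma first_origin j : j < N -> (origin (g 0 j) == Some false) = (j < O).
Proof.
move=> lt; have := tableau_tile (leq0n S) lt; rewrite nth_labels //= nth_first_row.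
rewrite -size_first_row lt => /and3P[_ _].
case: (ltnP j O) => l1 /=; first by case/and5P => _ _ /eqP ->.
case: (ltnP j (O + size (delimit x))) => l2 /=; first by case/and5P => _ _ /eqP ->.
by case: (ltnP j (O + size (delimit x) + B)) => l3 /=; case/and5P => _ _ /eqP ->.
Qed.

Lemma origin_column r j : r <= S -> j < N -> origin (g r j) = compare (column j) 0.
Proof.
move=> le lt; have -> : origin (g r j) = origin (g 0 j).
  elim: r le => // r IH le; rewrite -IH; last exact: ltnW.
  have := tableau_column le lt; rewrite /column_ok; case: transition => q act.
  by case/and3P => /eqP.
have NO : O < N by have := N_gt; lia.
have fol i : i.+1 < N -> follows (origin (g 0 i)) (origin (g 0 i.+1)).
  (* The exemption of [row_ok] for ends of rows cannot apply inside the first row: a cell followed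
     by one left of the origin is itself left of it. *)
  move=> l; have /orP[/andP[/eqP E1 E2]|/and5P[]//] := tableau_row (leq0n S) l.
  rewrite first_origin // in E2.
  by have := first_origin (ltnW l); rewrite E1 (ltnW E2).
rewrite -columnO compare_column; apply: (@follows_uniq N O (fun i => origin (g 0 i))) => //.
(* Column [O] is not left of the origin but its left neighbour is; [follows] leaves only [None]. *)
have := fol S.+1 NO; have := first_origin NO; rewrite ltnn.
have /eqP -> : origin (g 0 S.+1) == Some false by rewrite first_origin //; exact: ltnW.
by case: (origin _) => [[]|].
Qed.

Lemma row_okP r j : r <= S -> j.+1 < N ->
  [/\ tstate (g r j) = tstate (g r j.+1), treads (g r j) = treads (g r j.+1),
      forall k, follows (head_side (g r j) k) (head_side (g r j.+1) k)
    & initial (g r j) -> initial (g r j.+1) -> O <= j ->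
      tsym (g r j) ord0 = blank -> tsym (g r j.+1) ord0 = blank].
Proof.
move=> le lt; have := tableau_row le lt; rewrite /row_ok !origin_column ?(ltnW lt) //.
rewrite -columnO !compare_column; case/orP.
  by case: (ltngtP j O) => l //; case: (ltngtP j.+1 O) => l' //; lia.
case/and5P => _ /eqP -> /eqP -> /forallP fol H; split=> // i i' l /eqP b.
move: H; rewrite i i' b /= => H; apply/eqP; apply: (implyP H).
by case: (ltngtP j O) l.
Qed.

Definition represents (c : config M) (r : nat) : Prop :=
  forall j, j < N ->
    [/\ tstate (g r j) = c_state c,
        treads (g r j) = scan c
      & forall k, tsym (g r j) k = c_tape c k (column j) /\
       head_side (g r j) k = compare (column j) (c_head c k)].

Lemma treads_row r i j : r <= S -> i < N -> j < N -> treads (g r i) = treads (g r j).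
Proof.
move=> le li lj.
have aux i' : i' < N -> treads (g r i') = treads (g r 0).
  elim: i' => // i' IH l; have [_ <- _ _] := row_okP le l.
  by apply: IH; exact: ltnW.
by rewrite !aux.
Qed.

Lemma head_column y r k : r <= S ->
  exists h, [/\ c_head (run y r) k = column h, 0 < h, h.+1 < N & h <= O + r].
Proof.
move=> le; have := run_head y r k; have := N_gt => NO H.
exists (absz (c_head (run y r) k + Posz O)%R); rewrite /column; split; lia.
Qed.

(** The recorded readings are constant along a row, and [tile_ok] compares each with the symbol in
    the column of its head, which lies inside the row. *)
Lemma scan_of_sym y r : r <= S ->
  (forall j, j < N -> forall k, tsym (g r j) k = c_tape (run y r) k (column j) /\
       head_side (g r j) k = compare (column j) (c_head (run y r) k)) ->
  forall j, j < N -> treads (g r j) = scan (run y r).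
Proof.
move=> le H j lt; apply/ffunP => k; rewrite ffunE.
have [h [Eh _ /ltnW lh _]] := head_column y k le.
rewrite (treads_row le lt lh) Eh.
have [<- Es] := H h lh k.
have /and3P[/forallP/(_ k) + _ _] := tableau_tile le lh.
by rewrite Es Eh /compare eqxx /= => /eqP.
Qed.

(** The labels fix the first row up to the symbols in the [B] free cells, and these spell [y]. *)
Lemma first_row_represents :
  exists2 y, size y <= B & represents (run y 0) 0.
Proof.
set D := size (delimit x).
have tile0 j : j < N -> _ := fun lt => tableau_tile (leq0n S) lt.
pose a i := tsym (g 0 (O + D + i)) ord0.
have lab j (lt : j < N) : exists l, [/\ nth LaterRow (first_row S B (delimit x)) j = l,
    l != LaterRow & [&& initial (g 0 j), tstate (g 0 j) == tm_start M,
       (origin (g 0 j) == Some false) == (l == LeftBlank),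
          [forall k, head_side (g 0 j) k == origin (g 0 j)],
          [forall k, (k != ord0) ==> (tsym (g 0 j) k == blank)]
        & match l with
          | InputBit b => tsym (g 0 j) ord0 == tm_bit M b
          | FreeBit => tsym (g 0 j) ord0 \in [:: tm_bit M true; tm_bit M false; blank]
          | _ => tsym (g 0 j) ord0 == blank
          end]].
  exists (nth LaterRow (first_row S B (delimit x)) j).
  have ne : nth LaterRow (first_row S B (delimit x)) j != LaterRow.
    rewrite nth_first_row -size_first_row lt.
    by do 3!case: ifP => //.
  split=> //; have := tile0 j lt; rewrite nth_labels // => /and3P[_ _].
  by rewrite [0 == 0]/= (negPf ne).
have ini j : j < N -> initial (g 0 j) by move=> /lab[l [_ _ /and5P[]]].
have szN : N = O + (D + (B + S.+1)) by rewrite size_first_row.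
have [y sz Ey] : exists2 y, size y <= B &
    forall i, i < B -> a i = nth blank (map (@tm_bit M) y) i.
  apply: free_word => [i lt|i lt].
    have lt' : O + D + i < N by lia.
    have [l [El _ /and5P[_ _ _ _ /andP[_]]]] := lab _ lt'.
    move: El; rewrite nth_first_row ifN; last by lia.
    by rewrite ifN; [rewrite ifT; [move=> <-|lia] | lia].
  rewrite /a addnS; have [||_ _ _] := @row_okP 0 (O + D + i) => //; first by lia.
  by apply; [apply: ini; lia | apply: ini; lia | lia].
exists y => //.
suff H : forall j, j < N -> forall k, tsym (g 0 j) k = c_tape (run y 0) k (column j) /\
     head_side (g 0 j) k = compare (column j) (c_head (run y 0) k).
  move=> j lt; split; [|exact: scan_of_sym|exact: H].
  by have [l [_ _ /and5P[_ /eqP]]] := lab j lt.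
move=> j lt k; have [l [El _ /and5P[_ _ _ /forallP hd /andP[/forallP oth sym]]]] := lab j lt.
split; last by rewrite (eqP (hd k)) origin_column.
rewrite /run /=; case: (eqVneq k ord0) => [->|ne]; last first.
  have /implyP/(_ ne)/eqP -> := oth k.
  by rewrite /word_tape; case: column => // i; rewrite nth_nil.
have Ecol : O <= j -> column j = Posz (j - O) by rewrite /column; lia.
move: El sym; rewrite nth_first_row -size_first_row lt.
case: (ltnP j O) => l1.
  move=> <- /eqP ->; rewrite /column.
  by case E: (_ - _)%R => [i|i] //; lia.
rewrite (Ecol l1) word_tapeE /pair_code map_cat nth_cat size_map ltn_subLR // -/D.
case: (ltnP j (O + D)) => l2.
  by move=> <- /eqP ->; rewrite (nth_map false) //; lia.
case: (ltnP j (O + D + B)) => l3 <-.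
  by move=> _; rewrite -Ey; [rewrite /a; congr (tsym (tau _) _); lia | lia].
by move=> /eqP ->; rewrite nth_default // size_map; lia.
Qed.

Lemma represents_step y r : r < S -> represents (run y r) r -> represents (run y r.+1) r.+1.
Proof.
move=> lt R; have le := ltnW lt.
have := step_transition (run y r); case Et : transition => [q act] [Eq Esym Ehead].
have col j : j < N -> tstate (g r.+1 j) = q /\ forall k,
    tsym (g r.+1 j) k = c_tape (run y r.+1) k (column j) /\
    moves_to (act k).2 (compare (column j) (c_head (run y r) k)) (head_side (g r.+1 j) k).
  move=> lj; have := tableau_column lt lj; rewrite /column_ok.
  have [-> -> Rk] := R j lj; rewrite Et => /and3P[_ /eqP-> /forallP H]; split=> // k.
  have /andP[/eqP -> mv] := H k; have [Es Eh] := Rk k.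
  rewrite Eh in mv *; split=> //; rewrite [run y r.+1]/= Esym Es /compare.
  by case: (column j =P _).
suff H : forall j, j < N -> forall k, tsym (g r.+1 j) k = c_tape (run y r.+1) k (column j) /\
       head_side (g r.+1 j) k = compare (column j) (c_head (run y r.+1) k).
  move=> j lj; split; [|exact: scan_of_sym|exact: H].
  by have [-> _] := col j lj; rewrite [run y r.+1]/= Eq.
move=> j lj k; split; first by have [_ /(_ k)[]] := col j lj.
have [h [Eh h0 hN _]] := head_column y k le.
have fol i : i.+1 < N -> follows (head_side (g r.+1 i) k) (head_side (g r.+1 i.+1) k).
  by move=> l; have [_ _ ->] := row_okP lt l.
have mv i : i < N -> moves_to (act k).2 (if i == h then None else Some (h < i))
    (head_side (g r.+1 i) k).
  by move=> l; have [_ /(_ k)[_]] := col i l; rewrite Eh compare_column.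
(* The new head column is found next to the old one: when the head moves, column [h] ends up on a
   definite side, and [moves_to] in the column it moves to, together with [follows], leaves only
   [None] there. *)
have [h' [Eh' h'N None']] : exists h', [/\ c_head (run y r.+1) k = column h', h' < N
    & head_side (g r.+1 h') k = None].
  rewrite [run y r.+1]/= Ehead Eh; have lh := ltnW hN.
  case: (act k).2 mv => mv /=.
  - have lp : h.-1 < N := leq_ltn_trans (leq_pred h) lh.
    exists h.-1; split; [by rewrite /column; lia | by [] | ].
    have := fol h.-1; rewrite prednK // => /(_ lh).
    have := mv h lh; rewrite eqxx /= => /eqP ->.
    have := mv h.-1 lp; rewrite ifN; last by lia.
    have -> : (h < h.-1) = false by lia.
    by case: (head_side _ k) => [[]|].
  - exists h; split; [by rewrite GRing.addr0 | by [] |].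
    by have := mv h lh; rewrite eqxx /= => /eqP.
  - exists h.+1; split; [by rewrite /column; lia | by [] | ].
    have := fol h hN.
    have := mv h lh; rewrite eqxx /= => /eqP ->.
    have := mv h.+1 hN; rewrite ifN; last by lia.
    have -> : (h < h.+1) = true by lia.
    by case: (head_side _ k) => [[]|].
rewrite Eh' compare_column.
exact: (@follows_uniq N h' (fun i => head_side (g r.+1 i) k)).
Qed.

(** By [bound] the machine has halted by row [S], so acceptance is imposed on the origin cell of
    that row, which holds the verdict of [V]. *)
Lemma run_of_tableau : exists2 y, size y <= B & V (pair_code x y).
Proof.
have [y sz R0] := first_row_represents; exists y => //.
have R r : r <= S -> represents (run y r) r.
  by elim: r => // r IH lt; apply: represents_step => //; apply: IH; exact: ltnW.
have hS : tm_halt (c_state (run y S)).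
  have := comp (pair_code x y); cbv zeta; rewrite -/(run y _) => -[h _].
  by rewrite (run_halted (bound sz) h).
have NO : O < N by have := N_gt; lia.
have [Es _ Ek] := R S (leqnn S) O NO.
have /and3P[_ + _] := tableau_tile (leqnn S) NO.
rewrite Es hS origin_column // columnO /compare eqxx /=.
have [-> _] := Ek ord_max; rewrite columnO run_output //.
by case: (V _) => // /eqP/tm_bit_inj.
Qed.

End Run_of_tiling.

Lemma tableauP : (exists tau, is_tableau tau) <-> exists y, size y <= B /\ V (pair_code x y).
Proof.
split=> [[tau H]|[y [sz acc]]]; last exact: tableau_of_run acc.
by have [y sz acc] := run_of_tableau H; exists y.
Qed.

End Simulation.

(** * The reduction is computed in polynomial time *)

Section Reduction.
Variables (m : nat) (conflict : bool -> rel 'I_m) (forbid : label -> pred 'I_m).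
Variables cy dy ct dt : nat.

(** The constants [cy], [dy] come from the length bound on certificates, [ct], [dt] from the running
    time of the verifier; [word_size] is the length of a pair code with a longest certificate. *)
Definition guess (n : nat) : nat := cy * n ^ dy + cy.
Definition word_size (n : nat) : nat := 2 * n + 1 + guess n.
Definition horizon (n : nat) : nat := ct * word_size n ^ dt + ct.

Definition top_row (x : seq bool) : seq label :=
  first_row (horizon (size x)) (guess (size x)) (delimit x).
Definition cell_labels (x : seq bool) : seq label :=
  labels (horizon (size x)) (guess (size x)) (delimit x).
Definition cell_number (x : seq bool) : nat := (horizon (size x)).+1 * size (top_row x).

Definition reduct (x : seq bool) : tvc_instance :=
  gadget_instance conflict (size (top_row x)) (cell_number x)
    (fun p => forbid (nth LaterRow (cell_labels x) p)).

Definition letter := option (bool + label + option bool).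
Definition bit (b : bool) : letter := Some (inl (inl b)).
Definition lab (l : label) : letter := Some (inl (inr l)).
Definition mark (r : option bool) : letter := Some (inr r).

Local Notation one := (bit true).
Local Notation blank := (None : letter).

Definition row_tail (x : seq bool) : seq label :=
  nseq (horizon (size x)) LeftBlank ++ map InputBit (delimit x) ++
  nseq (guess (size x)) FreeBit ++ nseq (horizon (size x)).+1 RightBlank.

Lemma top_rowE x : top_row x = [:: LeftBlank, LeftBlank & row_tail x].
Proof. by []. Qed.

(* Its letter at offset [p - q] tells the position of the cell [p] relative to
   the cell [q]. *)
Definition ruler (x : seq bool) : seq letter :=
  [:: mark None; mark (Some false)] ++ nseq (size (row_tail x)) one ++ [:: mark (Some true)].

Ltac bool_lhs := first [rewrite -[LHS]/true | rewrite -[LHS]/false].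

(** The marks sit at the offsets 0, 1 and the row width, which are distinct because a row starts
    with at least two [LeftBlank] cells. No other offset, negative ones included, carries a mark. *)
Lemma ruler_mark x p q r :
  (cell blank (ruler x) (Posz p - Posz q)%R == mark r) = (rel_cell (size (top_row x)) r q == p).
Proof.
rewrite top_rowE /=; set e := size (row_tail x).
have cut (a : nat) : (Posz p - Posz q)%R = Posz a -> p = q + a by lia.
case E: (Posz p - Posz q)%R => [a|a] /=; last first.
  by case: r => [[]|]; rewrite /rel_cell /gap; bool_lhs; lia.
rewrite (cut a E).
case: a E => [|[|a]] E /=.
- by case: r => [[]|]; rewrite /rel_cell /gap; bool_lhs; lia.
- by case: r => [[]|]; rewrite /rel_cell /gap; bool_lhs; lia.
- rewrite nth_cat size_nseq -/e nth_nseq.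
  case: ltnP => [l|l].
    by case: r => [[]|]; rewrite /rel_cell /gap; bool_lhs; lia.
  case: (eqVneq a e) => [->|ne].
    by rewrite subnn; case: r => [[]|]; rewrite /rel_cell /gap; bool_lhs; lia.
  rewrite nth_default; last by rewrite /=; lia.
  by case: r => [[]|]; rewrite /rel_cell /gap; bool_lhs; lia.
Qed.

Definition local_adjacent (l : label) (h : time m) (u v : option bool * vertex m) : bool :=
  let joins a b := (a.1 == None) &&
    has (fun e => (e.1 == a.2) && (e.2 == b)) (local_edges conflict (forbid l) h) in
  joins u v || joins v u.

(** For fixed [h], [g] and [g'], a matrix entry depends only on the label of the cell [q] and on the
    positions of [p] and [p'] relative to [q]. These are three scanned letters, so a single [Append]
    prints it. *)
Definition edge_bit (h : time m) (g g' : vertex m) (r : nat -> letter) : letter :=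
  bit (match r 5, r 8, r 9 with
       | Some (inl (inr l)), Some (inr a), Some (inr b) => local_adjacent l h (a, g) (b, g')
       | _, _, _ => false
       end).

Lemma edge_bitE x q h p g p' g' (r : nat -> letter) :
  r 5 = lab (nth LaterRow (cell_labels x) q) ->
  r 8 = cell blank (ruler x) (Posz p - Posz q)%R ->
  r 9 = cell blank (ruler x) (Posz p' - Posz q)%R ->
  edge_bit h g g' r = bit (adjacent conflict (size (top_row x))
    (fun p => forbid (nth LaterRow (cell_labels x) p)) (q, h) (p, g) (p', g')).
Proof.
move=> R5 R8 R9; rewrite /edge_bit R5 /lab; congr bit; set l := nth _ _ q.
have key p1 p2 g1 g2 :
    gedge conflict (size (top_row x)) (fun p => forbid (nth LaterRow (cell_labels x) p))
      (q, h) (p1, g1) (p2, g2) =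
    (cell blank (ruler x) (Posz p1 - Posz q)%R == mark None) &&
    has (fun e => (e.1 == g1) && ((cell blank (ruler x) (Posz p2 - Posz q)%R == mark e.2.1)
                  && (e.2.2 == g2))) (local_edges conflict (forbid l) h).
  rewrite /gedge /= ruler_mark /= eq_sym; congr andb.
  by apply: eq_has => e; rewrite ruler_mark.
have noedge a b g1 g2 : (forall c, (a == mark c) = false) \/ (forall c, (b == mark c) = false) ->
    (a == mark None) && has (fun e => (e.1 == g1) && ((b == mark e.2.1) && (e.2.2 == g2)))
      (local_edges conflict (forbid l) h) = false.
  case=> H; first by rewrite H.
  by rewrite (@eq_has _ _ pred0) ?has_pred0 ?andbF // => e; rewrite H andbF.
have nomark a : (if a is Some (inr _) then false else true) -> forall c, (a == mark c) = false.
  by case: a => [[]|].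
rewrite /adjacent !key -R8 -R9 /local_adjacent.
have joinE a b g1 g2 : (mark a == mark None) && has (fun e => (e.1 == g1) &&
      ((mark b == mark e.2.1) && (e.2.2 == g2))) (local_edges conflict (forbid l) h)
    = (a == None) && has (fun e => (e.1 == g1) && (e.2 == (b, g2)))
        (local_edges conflict (forbid l) h).
  congr andb; apply: eq_has => -[e1 [e2 e3]] /=; rewrite -pair_eqE /= /pair_eq /= [e2 == b]eq_sym.
  by [].
case E8: (r 8) => [[c|a]|]; try by rewrite !noedge; auto.
case E9: (r 9) => [[c|b]|]; try by rewrite !noedge; auto.
by rewrite -[Some (inr a)]/(mark a) -[Some (inr b)]/(mark b) !joinE.
Qed.

Definition copy_bit (r : nat -> letter) : letter :=
  if r 0 is Some (inl (inl b)) then lab (InputBit b) else blank.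

Definition write_ruler (k : nat) : prog letter :=
  Seq (puts k [:: mark None; mark (Some false)])
    (Seq (foreach 4 [::] (puts k [:: one])) (puts k [:: mark (Some true)])).

(* Tape 0 holds the input, tapes 1, 2 and 3 the numbers [guess], [word_size] and
   [horizon] in unary, tape 4 the first row without its first two labels, tape 5
   the labels of all cells, tapes 6 and 7 the number of cells in unary, tapes 8 and
   9 the ruler; the tapes from 10 on hold powers. *)
Definition prepare : prog letter :=
  Seq (write_polynomial one 0 10 1 cy dy)
  (Seq (make 2 (Seq (foreach 0 [::] (puts 2 [:: one; one]))
         (Seq (puts 2 [:: one]) (foreach 1 [::] (puts 2 [:: one])))))
  (Seq (write_polynomial one 2 (11 + dy) 3 ct dt)
  (Seq (make 4 (Seq (foreach 3 [::] (puts 4 [:: lab LeftBlank]))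
         (Seq (foreach 0 [::] (Seq (puts 4 [:: lab (InputBit true)]) (Append 4 copy_bit)))
         (Seq (puts 4 [:: lab (InputBit false)])
         (Seq (foreach 1 [::] (puts 4 [:: lab FreeBit]))
         (Seq (foreach 3 [::] (puts 4 [:: lab RightBlank])) (puts 4 [:: lab RightBlank])))))))
  (Seq (make 5 (Seq (puts 5 [:: lab LeftBlank; lab LeftBlank])
         (Seq (foreach 4 [::] (Append 5 (fun r => r 4)))
           (foreach 3 [::] (Seq (puts 5 [:: lab LaterRow; lab LaterRow])
              (foreach 4 [::] (puts 5 [:: lab LaterRow])))))))
  (Seq (make 6 (foreach 5 [::] (puts 6 [:: one])))
  (Seq (make 7 (foreach 5 [::] (puts 7 [:: one])))
  (Seq (make 8 (write_ruler 8)) (make 9 (write_ruler 9))))))))).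

Definition tail_size (n : nat) : nat := horizon n + (2 * n + 1 + (guess n + (horizon n + 1))).
Definition area (n : nat) : nat := (horizon n + 1) * (tail_size n + 2).

Definition prepare_time (n : nat) : nat :=
  polynomial_cost cy dy n +
  (n * 7 + 4 + (2 + (guess n * 6 + 4)) + 2 * word_size n + 3 +
  (polynomial_cost ct dt (word_size n) +
  (horizon n * 6 + 4 + (n * 7 + 4 + (2 + (guess n * 6 + 4 + (horizon n * 6 + 4 + 2))))
     + 2 * tail_size n + 3 +
  (3 + (tail_size n * 5 + 4 + (horizon n * (3 + (tail_size n * 6 + 4) + 4) + 4))
     + 2 * area n + 3 +
  (area n * 6 + 4 + 2 * area n + 3 +
  (area n * 6 + 4 + 2 * area n + 3 +
  (3 + (tail_size n * 6 + 4 + 2) + 2 * (tail_size n + 3) + 3 +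
   (3 + (tail_size n * 6 + 4 + 2) + 2 * (tail_size n + 3) + 3)))))))).

Lemma size_row_tail x : size (row_tail x) = tail_size (size x).
Proof.
by rewrite /row_tail !size_cat !size_nseq size_map size_delimit /tail_size; lia.
Qed.

Lemma size_top_row x : size (top_row x) = tail_size (size x) + 2.
Proof. by rewrite top_rowE /= size_row_tail addn2. Qed.

Lemma size_cell_labels x : size (cell_labels x) = area (size x).
Proof.
rewrite /cell_labels /labels size_cat size_nseq -/(top_row x) size_top_row /area.
by rewrite mulnDl mul1n addnC.
Qed.

Lemma cell_numberE x : cell_number x = area (size x).
Proof. by rewrite /cell_number size_top_row /area addn1. Qed.

Lemma blank_map (T : Type) (F : T -> letter) w :
  (forall y, F y != blank) -> blank \notin map F w.
Proof. by move=> H; elim: w => //= y w IH; rewrite inE eq_sym negb_or H. Qed.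

Lemma flatten_nseq1 (T : Type) a (y : T) : flatten (nseq a [:: y]) = nseq a y.
Proof. by elim: a => //= a ->. Qed.

(** The powers occupy the tapes 10 to [10 + dy] and [11 + dy] to [11 + dy + dt]; the next tape is
    the output. *)
Local Notation out := (dy + dt).+4.+4.+4.

Lemma exec_prepare x : exists s t,
  [/\ exec blank prepare (input bit x) s t, t <= prepare_time (size x),
      s 5 = (map lab (cell_labels x), 0%R),
      [/\ s 6 = (nseq (cell_number x) one, 0%R), s 7 = (nseq (cell_number x) one, 0%R),
          s 8 = (ruler x, 0%R) & s 9 = (ruler x, 0%R)]
    & s out = ([::], 0%R)].
Proof.
set n := size x; set s0 := input bit x.
have s00 : s0 0 = (map bit x, 0%R) by [].
have s0E j : 0 < j -> s0 j = ([::], 0%R) by case: j.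
have bx : blank \notin map bit x by apply: blank_map.
have b1 a : blank \notin nseq a one by rewrite mem_nseq andbF.
have szx : size (map bit x) = n by rewrite size_map.
have [s1 [t1 [e1 l1 E1 F1]]] := @exec_write_polynomial _ blank one isT 0 10 1 cy dy s0
  (map bit x) s00 bx isT isT isT (fun i _ => s0E (10 + i) isT) (s0E 1 isT).
rewrite szx in E1 l1.
have s10 : s1 0 = (map bit x, 0%R) by rewrite F1.
have s12 : s1 2 = ([::], 0%R) by rewrite F1.
have [|t2 l2 e2] := @exec_make _ blank 2 (Seq (foreach 0 [::] (puts 2 [:: one; one]))
         (Seq (puts 2 [:: one]) (foreach 1 [::] (puts 2 [:: one]))))
    s1 (nseq (word_size n) one) (n * 7 + 4 + (2 + (guess n * 6 + 4))) s12 (b1 _).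
  have -> : nseq (word_size n) one = flatten (nseq (size (map bit x)) [:: one; one]) ++
      ([:: one] ++ flatten (nseq (size (nseq (guess n) one)) [:: one])).
    have dbl k : nseq (2 * k) one = flatten (nseq k [:: one; one]).
      by rewrite mulnC; elim: k => //= k ->.
    by rewrite szx size_nseq flatten_nseq1 -dbl /word_size !nseqD -catA.
  apply: emits_seq; first by rewrite -[in X in emits _ _ _ _ _ X]szx; apply: emits_foreach_puts; rewrite ?s12.
  apply: emits_seq; first by apply: emits_puts; rewrite s12.
  rewrite -[in X in emits _ _ _ _ _ X](size_nseq (guess n) one).
  by apply: emits_foreach_puts; rewrite ?s12 ?E1.
set s2 := upd s1 2 _ in e2.
have s2E j : j != 2 -> s2 j = s1 j by move=> ne; rewrite /s2 /upd (negPf ne).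
have s22 : s2 2 = (nseq (word_size n) one, 0%R) by [].
have s23 : s2 3 = ([::], 0%R) by rewrite s2E // F1.
have free i : i <= dt -> s2 (11 + dy + i) = ([::], 0%R).
  by move=> _; rewrite s2E ?F1 ?s0E //; lia.
have [s3 [t3 [e3 l3 E3 F3]]] := @exec_write_polynomial _ blank one isT 2 (11 + dy) 3 ct dt s2
  _ s22 (b1 _) isT isT isT free s23; rewrite size_nseq -/(horizon n) in E3 l3.
have s30 : s3 0 = (map bit x, 0%R) by rewrite F3 // s2E.
have s31 : s3 1 = (nseq (guess n) one, 0%R) by rewrite F3 // s2E.
have s3E j : 3 < j < 10 -> s3 j = ([::], 0%R).
  by move=> H; rewrite F3 ?s2E ?F1 ?s0E //; lia.
have s3o : s3 out = ([::], 0%R) by rewrite F3 ?s2E ?F1 ?s0E //; lia.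
have foreach1 s k a (l : seq letter) j T : s j = (nseq a one, 0%R) -> j != k -> s k = ([::], 0%R) ->
    a * (size l + 5) + 4 = T ->
    emits blank (foreach j [::] (puts k l)) s k (flatten (nseq a l)) T.
  move=> sj jk sk <-; have := @emits_foreach_puts _ blank j s k (nseq a one) l sj (b1 _) jk.
  by rewrite size_nseq sk; apply.
have puts1 s k (l : seq letter) T : s k = ([::], 0%R) -> size l + 1 = T ->
    emits blank (puts k l) s k l T.
  by move=> sk <-; apply: emits_puts; rewrite sk.
have bl (w : seq label) : blank \notin map lab w by apply: blank_map.
have s34 : s3 4 = ([::], 0%R) := s3E 4 isT.
have [|t4 l4 e4] := @exec_make _ blank 4 (Seq (foreach 3 [::] (puts 4 [:: lab LeftBlank]))
         (Seq (foreach 0 [::] (Seq (puts 4 [:: lab (InputBit true)]) (Append 4 copy_bit)))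
         (Seq (puts 4 [:: lab (InputBit false)])
         (Seq (foreach 1 [::] (puts 4 [:: lab FreeBit]))
         (Seq (foreach 3 [::] (puts 4 [:: lab RightBlank])) (puts 4 [:: lab RightBlank]))))))
    s3 (map lab (row_tail x))
    (horizon n * 6 + 4 + (n * 7 + 4 + (2 + (guess n * 6 + 4 + (horizon n * 6 + 4 + 2)))))
    s34 (bl _).
  have -> : map lab (row_tail x) = flatten (nseq (horizon n) [:: lab LeftBlank]) ++
      (flatten (mkseq (fun i => [:: lab (InputBit true)] ++ [:: lab (InputBit (nth false x i))]) n) ++
      ([:: lab (InputBit false)] ++ (flatten (nseq (guess n) [:: lab FreeBit]) ++
      (flatten (nseq (horizon n) [:: lab RightBlank]) ++ [:: lab RightBlank])))).
    rewrite (flatten_mkseq false (fun b => [:: lab (InputBit true)] ++ [:: lab (InputBit b)])).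
    rewrite !flatten_nseq1 /row_tail /delimit !map_cat !map_nseq -catA; congr cat.
    have -> : nseq (horizon (size x)).+1 (lab RightBlank) =
      nseq (horizon n) (lab RightBlank) ++ [:: lab RightBlank] by rewrite -addn1 nseqD.
    congr cat; by rewrite !map_flatten -!map_comp.
  apply: emits_seq; first by apply: foreach1.
  apply: emits_seq.
    have := @emits_foreach _ blank 0 [::] (Seq (puts 4 [:: lab (InputBit true)]) (Append 4 copy_bit))
      s3 4 (map bit x) (fun i => [:: lab (InputBit true)] ++ [:: lab (InputBit (nth false x i))]) 3
      s30 bx isT erefl.
    rewrite szx; apply=> i lt; apply: (@emits_seq _ _ _ _ _ _ _ _ 2 1).
      by apply: puts1 => //; rewrite slides_other // s3E.
    apply: emits_append; first by rewrite slides_other // s3E.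
    by move=> v; rewrite /copy_bit reading_emit // reading_slides ?s30 //= (nth_map false).
  apply: emits_seq; first by apply: puts1.
  apply: emits_seq; first by apply: foreach1.
  apply: emits_seq; first by apply: foreach1.
  by apply: puts1.
rewrite size_map size_row_tail in l4.
set s4 := upd s3 4 _ in e4.
have s4E j : j != 4 -> s4 j = s3 j by move=> ne; rewrite /s4 /upd (negPf ne).
have s44 : s4 4 = (map lab (row_tail x), 0%R) by [].
have s43 : s4 3 = (nseq (horizon n) one, 0%R) by rewrite s4E.
have foreach4 s k (l : seq letter) T : s 4 = (map lab (row_tail x), 0%R) -> k != 4 ->
    s k = ([::], 0%R) -> tail_size n * (size l + 5) + 4 = T ->
    emits blank (foreach 4 [::] (puts k l)) s k (flatten (nseq (tail_size n) l)) T.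
  move=> sj jk sk <-; have := @emits_foreach_puts _ blank 4 s k _ l sj (bl _).
  by rewrite eq_sym jk size_map size_row_tail sk; apply.
have [|t5 l5 e5] := @exec_make _ blank 5 (Seq (puts 5 [:: lab LeftBlank; lab LeftBlank])
         (Seq (foreach 4 [::] (Append 5 (fun r => r 4)))
           (foreach 3 [::] (Seq (puts 5 [:: lab LaterRow; lab LaterRow])
              (foreach 4 [::] (puts 5 [:: lab LaterRow]))))))
    s4 (map lab (cell_labels x))
    (3 + (tail_size n * 5 + 4 + (horizon n * (3 + (tail_size n * 6 + 4) + 4) + 4)))
    (s3E 5 isT) (bl _).
  have -> : map lab (cell_labels x) = [:: lab LeftBlank; lab LeftBlank] ++
      (map lab (row_tail x) ++ nseq (horizon n * (tail_size n + 2)) (lab LaterRow)).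
    by rewrite /cell_labels /labels -/(top_row x) size_top_row top_rowE map_cat map_nseq.
  have s45 : s4 5 = ([::], 0%R) by rewrite s4E // s3E.
  apply: emits_seq; first exact: puts1.
  apply: emits_seq.
    have := @emits_foreach _ blank 4 [::] (Append 5 (fun r => r 4)) s4 5
      (map lab (row_tail x)) (fun i => [:: nth blank (map lab (row_tail x)) i]) 1 s44 (bl _) isT erefl.
    rewrite flatten_mkseq1 size_map size_row_tail; apply=> i lt.
    apply: emits_append; first by rewrite slides_other // s45.
    by move=> v; rewrite reading_emit // reading_slides ?s44.
  rewrite -flatten_nseq.
  have := @emits_foreach _ blank 3 [::] (Seq (puts 5 [:: lab LaterRow; lab LaterRow])
    (foreach 4 [::] (puts 5 [:: lab LaterRow]))) s4 5 (nseq (horizon n) one)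
    (fun=> nseq (tail_size n + 2) (lab LaterRow)) (3 + (tail_size n * 6 + 4)) s43 (b1 _) isT erefl.
  rewrite size_nseq muln0 addn0; apply=> i _.
  have -> : nseq (tail_size n + 2) (lab LaterRow) = [:: lab LaterRow; lab LaterRow] ++
    flatten (nseq (tail_size n) [:: lab LaterRow]) by rewrite addnC nseqD flatten_nseq1.
  apply: emits_seq; first by apply: puts1; rewrite ?slides_other.
  by apply: foreach4; rewrite ?slides_other.
rewrite size_map size_cell_labels in l5.
set s5 := upd s4 5 _ in e5.
have s55 : s5 5 = (map lab (cell_labels x), 0%R) by [].
have foreach5 s k (l : seq letter) T : s 5 = (map lab (cell_labels x), 0%R) -> k != 5 ->
    s k = ([::], 0%R) -> area n * (size l + 5) + 4 = T ->
    emits blank (foreach 5 [::] (puts k l)) s k (flatten (nseq (area n) l)) T.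
  move=> sj jk sk <-; have := @emits_foreach_puts _ blank 5 s k _ l sj (bl _).
  by rewrite eq_sym jk size_map size_cell_labels sk; apply.
have s56 : s5 6 = ([::], 0%R) := s3E 6 isT.
have [|t6 l6 e6] := @exec_make _ blank 6 (foreach 5 [::] (puts 6 [:: one])) s5
    (nseq (area n) one) (area n * 6 + 4) s56 (b1 _).
  by rewrite -flatten_nseq1; apply: foreach5.
rewrite size_nseq in l6; set s6 := upd s5 6 _ in e6.
have s67 : s6 7 = ([::], 0%R) := s3E 7 isT.
have [|t7 l7 e7] := @exec_make _ blank 7 (foreach 5 [::] (puts 7 [:: one])) s6
    (nseq (area n) one) (area n * 6 + 4) s67 (b1 _).
  by rewrite -flatten_nseq1; apply: foreach5.
rewrite size_nseq in l7; set s7 := upd s6 7 _ in e7.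
have bruler : blank \notin ruler x by rewrite /ruler mem_cat mem_cat !inE (negPf (b1 _)).
have szruler : size (ruler x) = tail_size n + 3.
  rewrite -size_row_tail /ruler; move: (size (row_tail x)) => e.
  by rewrite size_cat size_cat size_nseq /=; lia.
have ruler_emits s k : s 4 = (map lab (row_tail x), 0%R) -> k != 4 -> s k = ([::], 0%R) ->
    emits blank (write_ruler k) s k (ruler x) (3 + (tail_size n * 6 + 4 + 2)).
  move=> H4 k4 sk; have -> : ruler x = [:: mark None; mark (Some false)] ++
      (flatten (nseq (tail_size n) [:: one]) ++ [:: mark (Some true)]).
    by rewrite flatten_nseq1 -size_row_tail.
  apply: emits_seq; first by apply: puts1.
  by apply: emits_seq; [apply: foreach4 | apply: puts1].
have s74 : s7 4 = (map lab (row_tail x), 0%R) by [].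
have s78 : s7 8 = ([::], 0%R) := s3E 8 isT.
have [t8 l8 e8] := exec_make s78 bruler (@ruler_emits s7 8 s74 isT s78).
rewrite szruler in l8; set s8 := upd s7 8 _ in e8.
have s89 : s8 9 = ([::], 0%R) := s3E 9 isT.
have s84 : s8 4 = (map lab (row_tail x), 0%R) by [].
have [t9 l9 e9] := exec_make s89 bruler (@ruler_emits s8 9 s84 isT s89).
rewrite szruler in l9; set s9 := upd s8 9 _ in e9.
exists s9, (t1 + (t2 + (t3 + (t4 + (t5 + (t6 + (t7 + (t8 + t9)))))))).
rewrite cell_numberE; split=> //.
- do 3!(apply: ExecSeq; first eassumption).
  apply: ExecSeq e4 _; apply: ExecSeq e5 _; apply: ExecSeq e6 _.
  by apply: ExecSeq e7 _; apply: ExecSeq e8 e9.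
- by rewrite size_nseq in l2; rewrite /prepare_time; repeat apply: leq_add.
Qed.

Local Notation V := {: vertex m}.
Local Notation Tm := {: time m}.

Definition parameters : seq bool := delimit (binary 2) ++ delimit (binary 0).

(** Loops over cells are loops over tapes, while those over the vertices and times of one cell are
    unrolled. Each cell loop also shifts ruler heads, so that their positions are always differences
    of cell numbers. *)
Definition emit_instance : prog letter :=
  Seq (foreach 5 [::] (puts out (nseq #|V| one)))
  (Seq (puts out [:: bit false])
  (Seq (foreach 5 [::] (puts out (nseq #|Tm| one)))
  (Seq (puts out [:: bit false])
  (Seq (puts out (map bit parameters))
    (foreach 5 [:: (8, false); (9, false)]
      (seqs (fun h => foreach 6 [:: (8, true)]
        (seqs (fun g => foreach 7 [:: (9, true)]
          (seqs (fun g' => Append out (edge_bit h g g')) (enum V)))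
        (enum V))) (enum Tm))))))).

Definition emission_time (n : nat) : nat :=
  area n * (#|V| + 5) + 4 + (2 + (area n * (#|Tm| + 5) + 4 + (2 +
  (size parameters + 1 +
   (area n * (#|Tm| * (area n * (#|V| * (area n * (#|V| * 1 + 1 + 2 * 1 + 4) + 4) + 1
      + 2 * 1 + 4) + 4) + 1 + 2 * 2 + 4) + 4))))).

Lemma emits_instance x s :
  s 5 = (map lab (cell_labels x), 0%R) ->
  s 6 = (nseq (cell_number x) one, 0%R) -> s 7 = (nseq (cell_number x) one, 0%R) ->
  s 8 = (ruler x, 0%R) -> s 9 = (ruler x, 0%R) -> s out = ([::], 0%R) ->
  emits blank emit_instance s out (map bit (tvc_encode (reduct x))) (emission_time (size x)).
Proof.
move=> s5 s6 s7 s8 s9 so; set n := size x; set c := cell_number x.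
have cE : c = area n := cell_numberE x.
have b1 a : blank \notin nseq a one by rewrite mem_nseq andbF.
have bl : blank \notin map lab (cell_labels x) by apply: blank_map.
have sz5 : size (map lab (cell_labels x)) = area n by rewrite size_map size_cell_labels.
have at_end : (s out).2 = Posz (size (s out).1) by rewrite so.
have unaryE a b : map bit (unary (a * b)) = flatten (nseq a (nseq b one)) ++ [:: bit false].
  rewrite /unary map_rcons map_nseq -cats1; congr cat.
  by rewrite -flatten_nseq /mkseq; elim: a 0 => //= a IH i; rewrite IH.
rewrite [tvc_encode _]gadget_encode [delimit (binary 2) ++ _]catA -/parameters.
rewrite 3!map_cat !unaryE -/c cE -!catA.
apply: emits_seq.
  have := @emits_foreach_puts _ blank 5 s out _ (nseq #|V| one) s5 bl isT at_end.
  by rewrite sz5 size_nseq.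
apply: emits_seq; first by apply: emits_puts.
apply: emits_seq.
  have := @emits_foreach_puts _ blank 5 s out _ (nseq #|Tm| one) s5 bl isT at_end.
  by rewrite sz5 size_nseq.
apply: emits_seq; first by apply: emits_puts.
apply: emits_seq; first by rewrite -(size_map bit); apply: emits_puts.
pose adj q h p g p' g' := adjacent conflict (size (top_row x))
  (fun p => forbid (nth LaterRow (cell_labels x) p)) (q, h) (p, g) (p', g').
have -> : map bit (gadget_bits conflict (size (top_row x)) (area n)
      (fun p => forbid (nth LaterRow (cell_labels x) p))) =
  flatten (mkseq (fun q => flatten (map (fun h => flatten (mkseq (fun p =>
    flatten (map (fun g => flatten (mkseq (fun p' => flatten (map (fun g' =>
      [:: bit (adj q h p g p' g')]) (enum V))) (area n))) (enum V))) (area n))) (enum Tm)))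
    (area n)).
  rewrite /gadget_bits /mkseq map_flatten -map_comp; congr flatten; apply: eq_map => q /=.
  rewrite map_flatten -map_comp; congr flatten; apply: eq_map => h /=.
  rewrite map_flatten -map_comp; congr flatten; apply: eq_map => p /=.
  rewrite map_flatten -map_comp; congr flatten; apply: eq_map => g /=.
  rewrite map_flatten -map_comp; congr flatten; apply: eq_map => p' /=.
  by elim: (enum V) => //= g' l ->.
apply: (emits_loop s5 bl sz5) => // q ltq.
rewrite [#|Tm|]cardE; apply: emits_seqs => h _.
set sq := slides _ _ s.
have sq6 : sq 6 = (nseq c one, 0%R) by rewrite /sq slides_other.
apply: (emits_loop sq6) => //; first by rewrite size_nseq.
move=> p ltp; rewrite {1}[#|V|]cardE; apply: emits_seqs => g _.
set sp := slides _ _ sq.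
have sp7 : sp 7 = (nseq c one, 0%R) by rewrite /sp slides_other // /sq slides_other.
apply: (emits_loop sp7) => //; first by rewrite size_nseq.
move=> p' ltp'; rewrite [#|V|]cardE; apply: emits_seqs => g' _.
apply: emits_append; first by rewrite slides_other // /sp slides_other // /sq slides_other.
move=> v; apply: edge_bitE; rewrite reading_emit //.
- rewrite /readings slides_other // /sp slides_other //.
  rewrite -/(readings blank sq 5) reading_slides ?s5 //; cbn [fst snd cell].
  rewrite (nth_map LaterRow) //.
  by rewrite size_cell_labels.
(* The loop over [q] has moved head 8 back by [q] and the loop over [p] has moved it forward by
   [p]. *)
- rewrite /readings /sp /sq /slides; cbn [fst snd]; rewrite s8; cbn [fst snd]; congr cell.
  rewrite (_ : offset [:: (5, true); (8, false); (9, false)] 8 = -1)%R //.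
  rewrite (_ : offset [:: (6, true); (8, true)] 8 = 1)%R //.
  by rewrite (_ : offset [:: (7, true); (9, true)] 8 = 0)%R //; lia.
- rewrite /readings /sp /sq /slides; cbn [fst snd]; rewrite s9; cbn [fst snd]; congr cell.
  rewrite (_ : offset [:: (5, true); (8, false); (9, false)] 9 = -1)%R //.
  rewrite (_ : offset [:: (6, true); (8, true)] 9 = 0)%R //.
  by rewrite (_ : offset [:: (7, true); (9, true)] 9 = 1)%R //; lia.
Qed.

(** * Polynomial bound on the running time *)

Ltac poly_bounds := solve [repeat first
  [ eassumption | exact: poly_bounded_const | exact: poly_bounded_id
  | apply: poly_bounded_exp | apply: poly_bounded_add | apply: poly_bounded_mul ]].

Lemma poly_bounded_power_cost d f :
  poly_bounded f -> poly_bounded (fun n => power_cost d (f n)).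
Proof.
move=> pf; elim: d => [|d IH]; first exact: poly_bounded_const.
rewrite /=; poly_bounds.
Qed.

Lemma poly_bounded_polynomial_cost c d f :
  poly_bounded f -> poly_bounded (fun n => polynomial_cost c d (f n)).
Proof.
move=> pf; have := poly_bounded_power_cost d pf; rewrite /polynomial_cost => H; poly_bounds.
Qed.

Lemma poly_bounded_time : poly_bounded (fun n => prepare_time n + emission_time n).
Proof.
have g : poly_bounded guess by rewrite /guess; poly_bounds.
have w : poly_bounded word_size by rewrite /word_size; poly_bounds.
have h : poly_bounded horizon by rewrite /horizon; poly_bounds.
have e : poly_bounded tail_size by rewrite /tail_size; poly_bounds.
have a : poly_bounded area by rewrite /area; poly_bounds.
have p1 := poly_bounded_polynomial_cost cy dy poly_bounded_id.
have p2 := poly_bounded_polynomial_cost ct dt w.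
rewrite /prepare_time /emission_time; poly_bounds.
Qed.

Ltac bounded_progs := repeat first
  [ apply: bounded_write_polynomial | apply: bounded_foreach | apply: bounded_make
  | apply: bounded_puts | apply: bounded_seq ].

Lemma bounded_reduction : bounded_by out (Seq prepare emit_instance).
Proof.
apply: bounded_seq.
  by bounded_progs => //; lia.
bounded_progs => //; apply: bounded_seqs => h.
apply: bounded_foreach => //; apply: bounded_seqs => g.
by apply: bounded_foreach => //; apply: bounded_seqs => g' /=.
Qed.

Lemma reduct_polynomial_time : polynomial_time (fun x => tvc_encode (reduct x)).
Proof.
have [c [d cd]] := poly_boundedP poly_bounded_time.
apply: (@prog_polynomial_time _ blank bit _ _ out (Seq prepare emit_instance) _ c d).
- by move=> a b [].
- by [].
- exact: bounded_reduction.
move=> x; have [s [t1 [e1 l1 s5 [s6 s7 s8 s9] so]]] := exec_prepare x.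
have [t2 l2 e2] := emits_exec (emits_instance s5 s6 s7 s8 s9 so).
exists (emit s out (map bit (tvc_encode (reduct x)))), (t1 + t2); split.
- exact: ExecSeq e1 e2.
- by apply: leq_trans (cd _); apply: leq_add.
- by rewrite /emit /upd eqxx so.
Qed.

End Reduction.

Theorem theorem4p7 :
  exists Delta : nat,
    NP_hard_on (P := timeline_vertex_cover)
      (fun I : tvc_instance =>
         [/\ tvc_k I = 2,
             tvc_l I = 0,
             imw (tvc_graph I) = 4,
             each_edge_once (tvc_graph I)
           & forall v, underlying_degree (tvc_graph I) v <= Delta]).
Proof.
exists 28 => L [V [cy [dy [[M [ct [dt comp]]] LP]]]].
(* The tile set depends on the verifier only, so [m] and the tables below are constants of the
   reduction. *)
pose m := #|{: tile M}|.
pose conflict (b : bool) (i j : 'I_m) :=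
  ~~ (if b then @column_ok M else @row_ok M) (enum_val i) (enum_val j).
pose forbid l (i : 'I_m) := ~~ tile_ok l (enum_val i : tile M).
have m0 : 0 < m.
  apply/card_gt0P.
  by exists (None, true, tm_start M, [ffun=> tm_blank M], [ffun=> (tm_blank M, None)]).
exists (reduct conflict forbid cy dy ct dt); split=> [|x|x].
- exact: reduct_polynomial_time.
- split=> //.
  + by apply: gadget_imw; rewrite cell_numberE /area muln_gt0; lia.
  + exact: gadget_each_edge_once.
  + exact: gadget_degree.
rewrite LP; set B := cy * _ + cy.
(* The time bound is monotone in the length, so [horizon] rows suffice for every admissible
   certificate. *)
have bound y : size y <= B -> ct * size (pair_code x y) ^ dt + ct <= horizon cy dy ct dt (size x).
  move=> le; rewrite /horizon leq_add2r leq_mul2l; apply/orP; right.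
  have le' : size (pair_code x y) <= word_size cy dy (size x).
    by rewrite size_cat size_delimit /word_size leq_add2l.
  by case: (posnP dt) => [->|d0]; rewrite ?expn0 ?leq_exp2r.
have [H1 H2] := tableauP comp bound.
have [G1 G2] := @gadget_yes m conflict (size (top_row cy dy ct dt x))
  (cell_number cy dy ct dt x) (fun p => forbid (nth LaterRow (cell_labels cy dy ct dt x) p))
  ltac:(rewrite top_rowE; exact: isT) m0.
split=> [/H2[tau H]|/G1[tau H]].
  apply: G2; exists (fun p => enum_rank (tau p)) => p lt.
  have [ok r c] := H p lt; split; first by rewrite /forbid enum_rankK negbK.
  by case=> l; rewrite /conflict !enum_rankK negbK; [exact: c | exact: r].
apply: H1; exists (fun p => enum_val (tau p)) => p lt.
have [ok rc] := H p lt; split; first by rewrite negbK in ok.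
- by move=> l; have := rc false l; rewrite negbK.
- by move=> l; have := rc true l; rewrite negbK.
Qed.
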